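(* Let $p\in[1,\infty)$. Suppose that $(X_i,d_i,e_i)_{i\in\mathbb N}$ is a sequence of pointed complete metric spaces with metric ultralimit $(\hat X,\hat d)$. Then there is a canonical isometric embedding of $(\mathcal P_p(\hat X),W_p)$ into $(\widehat{\mathcal P_p(X)},\hat W_p)$, the metric ultralimit of the pointed metric spaces $(\mathcal P_p(X_i),W_p,\delta_{e_i})_{i\in\mathbb N}$, extending the map $$(\mathcal P_p(\hat X),W_p)\ni \delta_{st_{\hat d}[(x_i)]}\longmapsto st_{\hat W_p}\left[(\delta_{x_i})\right]\in(\widehat{\mathcal P_p(X)},\hat W_p).$$
   Context: Fix a non-principal ultrafilter $\omega$ on $\mathbb N$. A property holds $\omega$-a.s. if the set of indices $i$ for which it holds belongs to $\omega$. For sets $(X_i)$, $X^\omega=\prod_i X_i/\sim_\omega$ is the ultraproduct, with $(x_i)\sim_\omega(x_i')$ iff $x_i=x_i'$ $\omega$-a.s.; classes are written $[(x_i)]$. $\mathbb R^\omega$ is the ultrapower of $\mathbb R$; $a\approx b$ means $|a-b|<\varepsilon$ for every standard real $\varepsilon>0$; $st(a)$ is the real $r$ with $a\approx r$ (if $a$ is finite). Metric ultralimit: for pointed metric spaces $(X_i,d_i,e_i)$ let $d^\omega([(x_i)],[(y_i)])=[(d_i(x_i,y_i))]\in\mathbb R^\omega$, $e^\omega=[(e_i)]$, and $X^\omega_{\lim}=\{x\in X^\omega: d^\omega(e^\omega,x)\text{ is finite}\}$. Then $\hat X$ is the quotient of $X^\omega_{\lim}$ by the relation $d^\omega(x,y)\approx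 0$, with $\hat d$ induced by $st(d^\omega(x,y))$; the quotient map is $st_{\hat d}:X^\omega_{\lim}\to\hat X$. For a metric space $Y$, $\mathcal P_p(Y)$ is the set of Radon probability measures on $Y$ (Borel probability measures inner regular with respect to compact sets) with finite $p$th moment, and $W_p(\mu,\nu)=\inf_{\gamma\in\Pi(\mu,\nu)}\left(\int d(x,y)^p\,d\gamma\right)^{1/p}$, where $\Pi(\mu,\nu)$ is the set of couplings. The space $(\widehat{\mathcal P_p(X)},\hat W_p)$ is the metric ultralimit of the pointed metric spaces $(\mathcal P_p(X_i),W_p,\delta_{e_i})$, with quotient map $st_{\hat W_p}:\mathcal P_p(X)^\omega_{\lim}\to\widehat{\mathcal P_p(X)}$. ''Canonical'' refers to the following map $\iota$: for a discrete measure $\frac1N\sum_{j=1}^N\delta_{\hat x_j}$ with $\hat x_j=st_{\hat d}[(x_{j,i})_{i\in\mathbb N}]$, $\iota\left(\frac1N\sum_{j=1}^N\delta_{\hat x_j}\right)=st_{\hat W_p}\left[\left(\frac1N\sum_{j=1}^N\delta_{x_{j,i}}\right)_{i\in\mathbb N}\right]$, and $\iota$ is extended to all of $\mathcal P_p(\hat X)$ by $W_p$-density of such discrete measures. *)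

(* Defs.v *)
From HB Require Import structures.
From mathcomp Require Import all_boot all_order all_algebra.
From mathcomp Require Import all_classical all_reals all_analysis.
From mathcomp Require Import measurable_realfun lra.

Set Implicit Arguments.
Unset Strict Implicit.
Unset Printing Implicit Defensive.
Import Order.TTheory GRing.Theory Num.Theory.
Import numFieldNormedType.Exports.
Local Open Scope classical_set_scope.
Local Open Scope ring_scope.

(* The point of a [pmetricType] only witnesses inhabitation, as elsewhere in  *)
(* the library; base points of pointed metric spaces are explicit arguments.  *)
#[short(type="pmetricType")]
HB.structure Definition PointedMetric (R : numDomainType) :=
  {T of Metric R T & PointedTopological T}.

#[short(type="completePMetricType")]
HB.structure Definition CompleteMetric (R : numDomainType) :=
  {T of PointedMetric R T & Complete T}.

(* The set of classes [r x]. Unlike [{eq_quot _}], it can be formed before    *)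
(* [r] is shown to be an equivalence relation.                                *)
Section quotient.
Variables (T : Type) (r : T -> T -> Prop).

Definition quot : Type := {A : set T | exists x, A = [set y | r x y]}.

Definition quot_pi (x : T) : quot :=
  exist _ [set y | r x y] (ex_intro _ x erefl).

Definition quot_repr (a : quot) : T := projT1 (cid (svalP a)).

Lemma quot_reprK : cancel quot_repr quot_pi.
Proof.
move=> a; rewrite /quot_repr; case: cid => /= x.
by case: a => A hA /= ax; apply: eq_sig_hprop => // *; exact: Prop_irrelevance.
Qed.

Lemma quot_piP : (forall x, r x x) -> (forall x y, r x y -> r y x) ->
  (forall x y z, r x y -> r y z -> r x z) ->
  forall x y, quot_pi x = quot_pi y <-> r x y.
Proof.
move=> rr rs rt x y; split => [[/seteqP[_ /(_ y)]]|xy]; first exact.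
apply: eq_sig_hprop => /=; first by move=> *; exact: Prop_irrelevance.
by apply/seteqP; split => z /=; [apply/rt/rs|exact: rt].
Qed.

End quotient.

Record free_ultrafilter := FreeUltrafilter {
  almost_surely : set_system nat ;
  ultra_filter : UltraFilter almost_surely ;
  ultra_nonprincipal : forall n, ~ almost_surely [set n] }.
#[global] Existing Instance ultra_filter.

Section ultraproduct.
Variable w : free_ultrafilter.

Definition ultraproduct (X : nat -> Type) : Type :=
  @quot (forall i, X i) (fun x y => almost_surely w [set i | x i = y i]).

Definition ultra_class (X : nat -> Type) (x : forall i, X i) :
  ultraproduct X := quot_pi _ x.

Definition ultra_repr (X : nat -> Type) (x : ultraproduct X) :
  forall i, X i := quot_repr x.

Lemma ultra_classP (X : nat -> Type) (x y : forall i, X i) :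
  ultra_class x = ultra_class y <-> almost_surely w [set i | x i = y i].
Proof.
apply: (@quot_piP _ (fun x y => almost_surely w [set i | x i = y i])).
- by move=> u; apply: filterE.
- by move=> u v; apply: filterS => i /= ->.
- by move=> u v t; apply: filterS2 => i /= -> ->.
Qed.

Lemma ultra_classK (X : nat -> Type) (x : forall i, X i) :
  almost_surely w [set i | ultra_repr (ultra_class x) i = x i].
Proof. by apply/ultra_classP; exact: quot_reprK. Qed.

Lemma ultra_reprK (X : nat -> Type) :
  cancel (@ultra_repr X) (@ultra_class X).
Proof. by move=> x; exact: quot_reprK. Qed.

Variable R : realType.

Definition hyperreal : Type := ultraproduct (fun=> R).

Definition standard (r : R) : hyperreal := ultra_class (fun=> r).

(* The properties below do not depend on the representatives: see [hfiniteP]  *)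
(* and [infinitely_closeP].                                                   *)
Definition hfinite (a : hyperreal) : Prop :=
  exists M : R, almost_surely w [set i | `|ultra_repr a i| <= M].

Definition infinitely_close (a b : hyperreal) : Prop := forall e : R, 0 < e ->
  almost_surely w [set i | `|ultra_repr a i - ultra_repr b i| < e].

Definition st (a : hyperreal) : R :=
  xget 0 [set r | infinitely_close a (standard r)].

Lemma hfiniteP (u : nat -> R) : hfinite (ultra_class u) <->
  exists M : R, almost_surely w [set i | `|u i| <= M].
Proof.
split=> -[M uM]; exists M.
  by move: uM (ultra_classK u); apply: filterS2 => i /= + uE; rewrite uE.
by move: uM (ultra_classK u); apply: filterS2 => i /= + uE; rewrite uE.
Qed.

Lemma infinitely_closeP (u v : nat -> R) :
  infinitely_close (ultra_class u) (ultra_class v) <->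
  forall e : R, 0 < e -> almost_surely w [set i | `|u i - v i| < e].
Proof.
by split=> uv e /uv {}uv; move: uv (ultra_classK u) (ultra_classK v);
  apply: filterS3 => i /= + uE vE; rewrite uE vE.
Qed.

Lemma st_unique (u : nat -> R) (r : R) :
  infinitely_close (ultra_class u) (standard r) -> st (ultra_class u) = r.
Proof.
move=> ur; apply: xget_unique => // s us.
apply/eqP; rewrite -subr_eq0 -normr_eq0 eq_le normr_ge0 andbT.
apply/ler_addgt0Pl => e e0; rewrite addr0.
have e20 : 0 < e / 2 by rewrite divr_gt0.
move/infinitely_closeP : ur => /(_ _ e20) ur.
move/infinitely_closeP : us => /(_ _ e20) us.
have [i [/= ui si]] := filter_ex (filterI ur us).
rewrite -(subrK (u i) s) -addrA (le_trans (ler_normD _ _))//.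
by rewrite [leRHS]splitr lerD ?(ltW ui)// distrC ltW.
Qed.

Lemma st_close (u : nat -> R) : hfinite (ultra_class u) ->
  infinitely_close (ultra_class u) (standard (st (ultra_class u))).
Proof.
move=> /hfiniteP[M uM].
have FF : ProperFilter (u @ almost_surely w) by exact: fmap_proper_filter.
have FM : (u @ almost_surely w) `[- M, M]%classic.
  by move: uM; apply: filterS => i /=; rewrite in_itv/= ler_norml.
have [r [_ rcl]] := @segment_compact R (- M) M _ FF FM.
suff ur : infinitely_close (ultra_class u) (standard r).
  by rewrite (st_unique ur).
apply/infinitely_closeP => e e0.
have [//|nu] := in_ultra_setVsetC [set i | `|u i - r| < e] (ultra_filter w).
have : (u @ almost_surely w) [set s | ~ `|s - r| < e] by exact: nu.
move=> /rcl /(_ (nbhsx_ballx r e e0)) [s [/= + rs]].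
by rewrite distrC.
Qed.

End ultraproduct.

Section ultralimit.
Variables (w : free_ultrafilter) (R : realType) (X : nat -> Type).
Variables (d : forall i, X i -> X i -> R) (e : forall i, X i).

Definition ultra_dist (x y : ultraproduct w X) : hyperreal w R :=
  ultra_class w (fun i => d (ultra_repr x i) (ultra_repr y i)).

Definition ultra_lim : Type :=
  {x : ultraproduct w X | hfinite (ultra_dist (ultra_class w e) x)}.

(* An equivalence relation as soon as the [d i] are pseudometrics; no metric  *)
(* axiom is needed to form the quotient, so this applies to [Wp] as it stands. *)
Definition metric_ultralimit : Type := @quot ultra_lim
  (fun x y => infinitely_close (ultra_dist (sval x) (sval y)) (standard w 0)).

Definition ultralimit_pi (x : ultra_lim) : metric_ultralimit := quot_pi _ x.

Definition ultralimit_dist (a b : metric_ultralimit) : R :=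
  st (ultra_dist (sval (quot_repr a)) (sval (quot_repr b))).

(* [ultralimit_st hx] is the image under the quotient map of the class of the *)
(* sequence [x], where [hx] states that this class lies in [ultra_lim].       *)
Definition limited (x : forall i, X i) : Prop :=
  hfinite (ultra_dist (ultra_class w e) (ultra_class w x)).

Definition ultralimit_st (x : forall i, X i) (hx : limited x) :
  metric_ultralimit := ultralimit_pi (exist _ (ultra_class w x) hx).

Lemma ultra_distE (x y : forall i, X i) :
  ultra_dist (ultra_class w x) (ultra_class w y) =
  ultra_class w (fun i => d (x i) (y i)).
Proof.
apply/ultra_classP; move: (ultra_classK w x) (ultra_classK w y).
by apply: filterS2 => i /= -> ->.
Qed.

Lemma limitedP (x : forall i, X i) : limited x <->
  exists M : R, almost_surely w [set i | `|d (e i) (x i)| <= M].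
Proof. by rewrite /limited ultra_distE; exact: hfiniteP. Qed.

End ultralimit.
Arguments ultralimit_st {w R X d e x}.

Section ultralimit_metric.
Variables (w : free_ultrafilter) (R : realType) (X : nat -> metricType R).
Variable e : forall i, X i.

Definition space_ultralimit : Type :=
  metric_ultralimit w (fun i => @mdist R (X i)) e.

Let D := @ultra_dist w R X (fun i => @mdist R (X i)).

Let near0 (x y : ultraproduct w X) : Prop :=
  infinitely_close (D x y) (standard w 0).

Let near0P (x y : ultraproduct w X) : near0 x y <-> forall eps : R, 0 < eps ->
  almost_surely w [set i | mdist (ultra_repr x i) (ultra_repr y i) < eps].
Proof.
rewrite /near0 infinitely_closeP.
by split=> xy eps /xy; apply: filterS => i /=; rewrite subr0 ger0_norm// mdist_ge0.
Qed.

Let near0_refl x : near0 x x.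
Proof.
by apply/near0P => eps eps0; apply: filterE => i /=; rewrite mdistxx.
Qed.

Let near0_sym x y : near0 x y -> near0 y x.
Proof.
move=> /near0P xy; apply/near0P => eps /xy.
by apply: filterS => i /=; rewrite metric_sym.
Qed.

Let near0_trans x y z : near0 x y -> near0 y z -> near0 x z.
Proof.
move=> /near0P xy /near0P yz; apply/near0P => eps eps0.
have e20 : 0 < eps / 2 by rewrite divr_gt0.
move: (xy _ e20) (yz _ e20); apply: filterS2 => i /= xyi yzi.
rewrite (le_lt_trans (metric_triangle _ (ultra_repr y i) _))//.
by rewrite [ltRHS]splitr ltrD.
Qed.

Let D_finite (x y : ultra_lim w (fun i => @mdist R (X i)) e) :
  hfinite (D (sval x) (sval y)).
Proof.
have /hfiniteP[M xM] := svalP x; have /hfiniteP[N yN] := svalP y.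
apply/hfiniteP; exists (M + N); move: xM yN; apply: filterS2 => i /=.
rewrite !ger0_norm ?mdist_ge0// => xM yN.
rewrite (le_trans (metric_triangle _ (ultra_repr (ultra_class w e) i) _))//.
by rewrite lerD// metric_sym.
Qed.

Let dist := @ultralimit_dist w R X (fun i => @mdist R (X i)) e.

Let distP (a b : space_ultralimit) (eps : R) : 0 < eps -> almost_surely w
  [set i | `|mdist (ultra_repr (sval (quot_repr a)) i)
                   (ultra_repr (sval (quot_repr b)) i) - dist a b| < eps].
Proof.
move=> eps0; have /infinitely_closeP := st_close (D_finite (quot_repr a) (quot_repr b)).
exact.
Qed.

Let distxx a : dist a a = 0.
Proof. by apply: st_unique; exact: near0_refl. Qed.

Let dist_positivity a b : dist a b = 0 -> a = b.
Proof.
move=> ab; rewrite -(quot_reprK a) -(quot_reprK b).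
apply/quot_piP.
- by move=> x; exact: near0_refl.
- by move=> x y; exact: near0_sym.
- by move=> x y z; exact: near0_trans.
- have := st_close (D_finite (quot_repr a) (quot_repr b)).
  by rewrite (_ : st _ = 0).
Qed.

Let dist_sym a b : dist a b = dist b a.
Proof.
apply: st_unique; apply/infinitely_closeP => eps /(@distP b a).
by apply: filterS => i /=; rewrite metric_sym.
Qed.

Let dist_triangle b a c : dist a c <= dist a b + dist b c.
Proof.
apply/ler_addgt0Pr => eps eps0.
have e30 : 0 < eps / 3 by rewrite divr_gt0.
have [i /= [[ac ab] bc]] := filter_ex (filterI (filterI (@distP a c _ e30)
  (@distP a b _ e30)) (@distP b c _ e30)).
move: ac ab bc; set x := ultra_repr _ i; set y := ultra_repr _ i.
set z := ultra_repr _ i.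
have := metric_triangle x z y.
rewrite !ltr_norml => t /andP[a1 a2] /andP[a3 a4] /andP[a5 a6].
by move: t a1 a2 a3 a4 a5 a6; rewrite -/x -/y; lra.
Qed.

HB.instance Definition _ := gen_eqMixin space_ultralimit.
HB.instance Definition _ := gen_choiceMixin space_ultralimit.

Let e_limited : limited w (fun i => @mdist R (X i)) e e.
Proof.
apply/limitedP; exists 0; apply: filterE => i /=.
by rewrite mdistxx normr0.
Qed.

HB.instance Definition _ :=
  isPointed.Build space_ultralimit (ultralimit_st e_limited).
HB.instance Definition _ := @isMetric.Build R space_ultralimit dist
  distxx dist_positivity dist_sym dist_triangle.

End ultralimit_metric.

HB.instance Definition _ (T U : ptopologicalType) :=
  Pointed.on (T * U)%type.

Notation borel T := (g_sigma_algebraType (@open T)).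

Section borel_lemmas.
Variable R : realType.

Lemma continuous_borel (T : ptopologicalType) (f : T -> R) :
  continuous f -> measurable_fun [set: borel T] (f : borel T -> R).
Proof.
move=> cf; apply: (measurability _ (RGenOpens.measurableE R)).
move=> _ [_ [a [b ->]] <-]; rewrite setTI; apply: sub_sigma_algebra.
by apply: open_comp => [x _|]; [exact: cf|exact: interval_open].
Qed.

Lemma mdist_continuous (Y : pmetricType R) :
  continuous (fun z : Y * Y => mdist z.1 z.2 : R).
Proof.
move=> [x y]; apply/cvgrPdist_lt => /= eps eps0.
have e20 : 0 < eps / 2 by rewrite divr_gt0.
exists (ball x (eps / 2), ball y (eps / 2)) => /=.
  by split; exact: nbhsx_ballx.
move=> [u v] /=; rewrite !ballEmdist /= => -[xu yv].
have h1 := metric_triangle x u y; have h2 := metric_triangle u v y.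
have h3 := metric_triangle u x v; have h4 := metric_triangle x y v.
rewrite (metric_sym v y) in h2; rewrite (metric_sym u x) in h3.
by rewrite ltr_norml; lra.
Qed.

Lemma measurable_mdist_powR (Y : pmetricType R) (p : R) :
  measurable_fun [set: borel (Y * Y)%type]
    (fun z : borel (Y * Y)%type => (mdist z.1 z.2 `^ p)%:E).
Proof.
apply/measurable_EFinP; apply: (measurableT_comp (measurable_powR _)) => //.
exact: (continuous_borel (@mdist_continuous Y)).
Qed.

Lemma measurable_mdistl_powR (Y : pmetricType R) (y : Y) (p : R) :
  measurable_fun [set: borel Y] (fun z : borel Y => (mdist y z `^ p)%:E).
Proof.
apply/measurable_EFinP; apply: (measurableT_comp (measurable_powR _)) => //.
apply: (@continuous_borel Y (fun z : Y => mdist y z)) => z.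
apply/cvgrPdist_lt => /= eps eps0; move: (nbhsx_ballx z eps eps0).
apply: filterS => u; rewrite ballEmdist /= => zu.
have h1 := metric_triangle y z u; have h2 := metric_triangle y u z.
by rewrite (metric_sym u z) in h2; rewrite ltr_norml; lra.
Qed.

End borel_lemmas.

Section empirical.
Local Open Scope ereal_scope.
Context d (T : measurableType d) (R : realType) (N : nat) (x : 'I_N.+1 -> T).

Definition empirical (A : set T) : \bar R :=
  (N.+1%:R^-1)%:E * \sum_(j < N.+1) \d_(x j) A.

Let k : {nonneg R} := (N.+1%:R^-1 : R)%:nng%R.

Let m : {measure set T -> \bar R} :=
  mscale k (msum (fun j => \d_(x (inord j)) : measure T R) N.+1).

Let empiricalE : empirical = m :> (set T -> \bar R).
Proof.
apply/funext => A; rewrite /empirical /m /mscale /msum /=.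
by congr (_ * _); apply: eq_bigr => j _; rewrite inord_val.
Qed.

Let empirical0 : empirical set0 = 0.
Proof. by rewrite empiricalE measure0. Qed.

Let empirical_ge0 A : 0 <= empirical A.
Proof. by rewrite empiricalE measure_ge0. Qed.

Let empirical_sigma_additive : semi_sigma_additive empirical.
Proof. by rewrite empiricalE; exact: measure_semi_sigma_additive. Qed.

HB.instance Definition _ := isMeasure.Build d T R empirical
  empirical0 empirical_ge0 empirical_sigma_additive.

Let empiricalT : empirical setT = 1.
Proof.
rewrite /empirical (eq_bigr (fun=> 1%:E)) => [|j _]; last first.
  by rewrite diracT.
by rewrite sumEFin sumr_const card_ord -EFinM mulVf// pnatr_eq0.
Qed.

HB.instance Definition _ := Measure_isProbability.Build d T R empirical
  empiricalT.

Lemma integral_empirical (f : T -> \bar R) : measurable_fun setT f ->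
  (forall t, 0 <= f t) ->
  \int[empirical]_t f t = (N.+1%:R^-1)%:E * \sum_(j < N.+1) f (x j).
Proof.
move=> mf f0; rewrite (eq_measure_integral m); last first.
  by move=> A _ _; exact: (congr1 (@^~ A) empiricalE).
rewrite ge0_integral_mscale// ge0_integral_measure_sum//; congr (_ * _).
apply: eq_bigr => j _.
by rewrite integral_dirac// inord_val diracT mul1e.
Qed.

End empirical.
Arguments empirical {d T R N} x A.

Section wasserstein.
Variables (R : realType) (p : R) (Y : pmetricType R).
Local Open Scope ereal_scope.

Definition inner_regular (mu : set (borel Y) -> \bar R) : Prop :=
  forall A : set (borel Y), measurable A ->
    mu A = ereal_sup [set mu K | K in [set K : set Y | compact K /\ K `<=` A]].

(* By the triangle inequality, the choice of [y] is irrelevant. *)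
Definition finite_moment (mu : set (borel Y) -> \bar R) : Prop :=
  exists y : Y, \int[mu]_x (mdist y x `^ p)%:E < +oo.

(* Terms of type [probability _ _] are functions on all sets: those that agree *)
(* on Borel sets stand for the same point of the Wasserstein space.            *)
Record wasserstein_space := WassersteinSpace {
  wmeasure :> probability (borel Y) R ;
  wmeasure_radon : inner_regular wmeasure ;
  wmeasure_moment : finite_moment wmeasure }.

(* The Borel sigma-algebra of the product may be larger than the product of    *)
(* the Borel sigma-algebras, for which [mdist] need not be measurable.         *)
Definition is_coupling (mu nu : set (borel Y) -> \bar R)
    (g : set (borel (Y * Y)%type) -> \bar R) : Prop :=
  forall A : set (borel Y), measurable A ->
    pushforward g (fst : borel (Y * Y)%type -> borel Y) A = mu A /\
    pushforward g (snd : borel (Y * Y)%type -> borel Y) A = nu A.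

Definition transport_cost (g : set (borel (Y * Y)%type) -> \bar R) : \bar R :=
  (\int[g]_z (mdist z.1 z.2 `^ p)%:E) `^ p^-1.

Definition Wp (mu nu : wasserstein_space) : R :=
  fine (ereal_inf [set transport_cost g |
    g in [set g : probability (borel (Y * Y)%type) R | is_coupling mu nu g]]).

Lemma inner_regular_finite (mu : {measure set (borel Y) -> \bar R}) (F : set Y) :
  finite_set F -> (forall A, mu (A `&` F) = mu A) -> inner_regular mu.
Proof.
move=> finF muF A mA; apply/eqP; rewrite eq_le; apply/andP; split.
  apply: ereal_sup_ubound; exists (A `&` F); last exact: muF.
  by split=> [|x []//]; apply: finite_compact; exact: finite_setIr.
apply: ge_ereal_sup => _ [K [cK KA] <-]; rewrite le_measure ?inE//.
rewrite -(setCK K); apply: measurableC; apply: sub_sigma_algebra.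
by apply: closed_openC; apply: compact_closed => //; exact: metric_hausdorff.
Qed.

Let dirac_radon (y : Y) : inner_regular (@dirac _ (borel Y) y R).
Proof.
apply: (@inner_regular_finite _ [set y]) => // A.
by rewrite /= !diracE in_setI (_ : y \in [set y]) ?andbT// inE.
Qed.

Let dirac_moment (y : Y) : finite_moment (@dirac _ (borel Y) y R).
Proof.
exists y; rewrite integral_dirac//; last exact: measurable_mdistl_powR.
by rewrite diracT mul1e ltry.
Qed.

Definition wdirac (y : Y) : wasserstein_space :=
  WassersteinSpace (dirac_radon y) (dirac_moment y).

Section wempirical.
Variables (N : nat) (x : 'I_N.+1 -> Y).

Let empirical_radon :
  inner_regular (@empirical _ (borel Y) R N (x : 'I_N.+1 -> borel Y)).
Proof.
apply: (@inner_regular_finite _ (range x)) => [|A].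
  exact: finite_image.
rewrite /= /empirical; congr (_ * _); apply: eq_bigr => j _.
rewrite !diracE in_setI (_ : x j \in range x) ?andbT//.
by rewrite inE; exists j.
Qed.

Let empirical_moment :
  finite_moment (@empirical _ (borel Y) R N (x : 'I_N.+1 -> borel Y)).
Proof.
exists point; rewrite integral_empirical; last 2 first.
- exact: measurable_mdistl_powR.
- by move=> t; rewrite lee_fin powR_ge0.
by rewrite sumEFin -EFinM ltry.
Qed.

Definition wempirical : wasserstein_space :=
  WassersteinSpace empirical_radon empirical_moment.

End wempirical.

Lemma Wp_ge0 (mu nu : wasserstein_space) : (0 <= Wp mu nu)%R.
Proof.
apply: fine_ge0; apply: le_ereal_inf_tmp => _ [g _ <-]; exact: poweR_ge0.
Qed.

Lemma Wp_le (mu nu : wasserstein_space) (g : probability (borel (Y * Y)%type) R)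
    (c : R) : is_coupling mu nu g -> transport_cost g <= c%:E -> (Wp mu nu <= c)%R.
Proof.
move=> mg gc; rewrite -lee_fin /Wp fineK.
  by apply: le_trans gc; apply: ereal_inf_lbound; exists g.
rewrite ge0_fin_numE; last by apply: le_ereal_inf_tmp => _ [h _ <-]; exact: poweR_ge0.
by apply: le_lt_trans (ltry c); apply: le_trans gc; apply: ereal_inf_lbound; exists g.
Qed.

Lemma Wp_dirac_le (y z : Y) (M : R) : (0 < p)%R ->
  (mdist y z <= M)%R -> (Wp (wdirac y) (wdirac z) <= M)%R.
Proof.
move=> p0 yzM; have M0 : (0 <= M)%R := le_trans (mdist_ge0 _ _) yzM.
apply: (@Wp_le _ _ (@dirac _ (borel (Y * Y)%type) (y, z) R)).
  by move=> A mA; split.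
rewrite /transport_cost integral_dirac//; last exact: measurable_mdist_powR.
rewrite diracT mul1e poweR_EFin lee_fin -powRrM mulfV ?gt_eqF//.
by rewrite powRr1// mdist_ge0.
Qed.

Lemma Wp_empirical_le (N : nat) (y : Y) (x : 'I_N.+1 -> Y) (M : R) :
  (0 < p)%R -> (forall j, mdist y (x j) <= M)%R ->
  (Wp (wdirac y) (wempirical x) <= M)%R.
Proof.
move=> p0 yxM.
have M0 : (0 <= M)%R := le_trans (mdist_ge0 _ _) (yxM ord0).
have N0 : (N.+1%:R != 0 :> R)%R by rewrite pnatr_eq0.
pose g := @empirical _ (borel (Y * Y)%type) R N (fun j => (y, x j)).
apply: (@Wp_le _ _ g).
  move=> A mA; split; last first.
    by rewrite /pushforward /= /empirical; congr (_ * _).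
  rewrite /pushforward /= /empirical (eq_bigr (fun=> @dirac _ (borel Y) y R A)) => [|j _]//.
  rewrite diracE sumEFin sumr_const card_ord -EFinM.
  by congr EFin; rewrite mulrnAr -mulrnAl -mulr_natl mulfV// mul1r.
rewrite /transport_cost integral_empirical; last 2 first.
- exact: measurable_mdist_powR.
- by move=> t; rewrite lee_fin powR_ge0.
rewrite sumEFin -EFinM poweR_EFin lee_fin.
rewrite [leRHS](_ : M = (M `^ p) `^ p^-1)%R; last first.
  by rewrite -powRrM mulfV ?gt_eqF// powRr1.
apply: ge0_ler_powR; rewrite ?nnegrE ?powR_ge0 ?invr_ge0 ?(ltW p0)//.
  by rewrite mulr_ge0 ?invr_ge0// sumr_ge0// => j _; exact: powR_ge0.
rewrite ler_pdivrMl ?ltr0n// mulr_natl -[X in (_ <= _ *+ X)%R](card_ord N.+1).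
rewrite -sumr_const ler_sum// => j _ /=.
by apply: ge0_ler_powR; rewrite ?nnegrE ?mdist_ge0 ?(ltW p0).
Qed.

End wasserstein.
Arguments is_coupling {R Y} mu nu g.
Arguments Wp {R p Y} mu nu.

Section canonical_map.
Variables (w : free_ultrafilter) (R : realType) (p : R) (p1 : 1 <= p).
Variables (X : nat -> pmetricType R) (e : forall i, X i).

Definition wasserstein_ultralimit : Type :=
  metric_ultralimit w (fun i => @Wp R p (X i)) (fun i => wdirac p (e i)).

Definition wasserstein_ultralimit_dist :
    wasserstein_ultralimit -> wasserstein_ultralimit -> R :=
  @ultralimit_dist w R _ (fun i => @Wp R p (X i)) (fun i => wdirac p (e i)).

Definition space_limited (x : forall i, X i) : Prop :=
  limited w (fun i => @mdist R (X i)) e x.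

Definition wasserstein_limited
    (mu : forall i, wasserstein_space p (X i)) : Prop :=
  limited w (fun i => @Wp R p (X i)) (fun i => wdirac p (e i)) mu.

Definition space_st (x : forall i, X i) (hx : space_limited x) :
  space_ultralimit w e := ultralimit_st hx.

Definition wasserstein_st (mu : forall i, wasserstein_space p (X i))
  (hmu : wasserstein_limited mu) : wasserstein_ultralimit := ultralimit_st hmu.

Let p0 : 0 < p. Proof. exact: lt_le_trans p1. Qed.

Lemma wdirac_limited (x : forall i, X i) : space_limited x ->
  wasserstein_limited (fun i => wdirac p (x i)).
Proof.
move=> /limitedP[M xM]; apply/limitedP; exists M; move: xM.
apply: filterS => i /=; rewrite !ger0_norm ?Wp_ge0 ?mdist_ge0//.
exact: Wp_dirac_le.
Qed.

Lemma wempirical_limited (N : nat) (x : 'I_N.+1 -> forall i, X i) :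
  (forall j, space_limited (x j)) ->
  wasserstein_limited (fun i => wempirical p (fun j => x j i)).
Proof.
move=> hx; have /choice[M xM] : forall j, exists M : R,
    almost_surely w [set i | `|mdist (e i) (x j i)| <= M].
  by move=> j; have /limitedP := hx j.
apply/limitedP; exists (\sum_j `|M j|).
have : almost_surely w [set i | forall j, `|mdist (e i) (x j i)| <= M j].
  exact: filter_forall.
apply: filterS => i /= xiM; rewrite ger0_norm ?Wp_ge0//.
apply: Wp_empirical_le => // j; rewrite (bigD1 j)//=.
rewrite (le_trans (ler_norm _))// (le_trans (xiM j))//.
by rewrite (le_trans (ler_norm _))// lerDl sumr_ge0.
Qed.

Definition is_empirical (Y : pmetricType R) (mu : wasserstein_space p Y) : Prop :=
  exists (N : nat) (x : 'I_N.+1 -> Y), mu = wempirical p x.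

(* The second clause is the extension from empirical measures by density.     *)
Definition canonical_map
    (iota : wasserstein_space p (space_ultralimit w e) ->
            wasserstein_ultralimit) : Prop :=
  (forall (N : nat) (x : 'I_N.+1 -> forall i, X i)
      (hx : forall j, space_limited (x j)),
    iota (wempirical p (fun j => space_st (hx j))) =
    wasserstein_st (wempirical_limited hx)) /\
  (forall (mu : wasserstein_space p (space_ultralimit w e))
      (nu : nat -> wasserstein_space p (space_ultralimit w e)),
    (forall n, is_empirical (nu n)) ->
    Wp (nu n) mu @[n --> \oo] --> 0 ->
    wasserstein_ultralimit_dist (iota (nu n)) (iota mu) @[n --> \oo] --> 0).

End canonical_map.

(* Main.v *)
Require Import Defs.
From HB Require Import structures.
From mathcomp Require Import all_boot all_order all_algebra.
From mathcomp Require Import all_classical all_reals all_analysis.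
From mathcomp Require Import measurable_realfun lra.

Set Implicit Arguments.
Unset Strict Implicit.
Unset Printing Implicit Defensive.
Import Order.TTheory GRing.Theory Num.Theory.
Import numFieldNormedType.Exports.
Local Open Scope classical_set_scope.
Local Open Scope ring_scope.

(** Why the theorem holds.

    Both spaces only see finite configurations of points.  A coupling of two
    empirical measures is in essence a matrix of weights, its cost depends on
    the mutual distances of the atoms alone, and changing each of these
    distances by at most [eps] changes [Wp] by at most [eps]
    ([Wp_empirical_transfer]).  Along the ultrafilter the finitely many
    distances [d_i (x_j,i) (y_k,i)] converge to those of the limit points, hence
    the prescribed map on empirical measures is isometric
    ([empirical_isometry]).  Empirical measures are dense in the Wasserstein
    space of the limit ([empirical_dense]) and every ultralimit is complete
    ([ultralimit_complete]), so this map has exactly one continuous extension,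
    and the extension is an isometry.  It identifies two measures only when
    they are at distance zero, that is, when they agree on Borel sets
    ([Wp_eq0]).

    All this needs [Wp] to be a finite pseudometric on the Radon measures of an
    arbitrary, possibly nonseparable, metric space; its triangle inequality
    makes the ultralimit of Wasserstein spaces independent of representatives.
    Two tools replace disintegration.

    - [gluing]: two probabilities carrying labels in the natural numbers with
      the same law have a coupling under which the labels agree almost surely.
      One takes, on each pair of cells with label [k], the normalized product.
      A Radon measure lives on a separable set, which splits into countably many
      cells of diameter at most [eps]; gluing two couplings along the cells of
      their common marginal gives the triangle inequality up to [eps].  With
      labels naming the atoms of an empirical measure, the same lemma transfers
      couplings from one configuration of points to another.

    - [coupling_of_maps]: two random points on any probability space with Radon
      laws induce a coupling of these laws.  The pair need not be measurable for
      the Borel sigma-algebra of the product, but it is so on the event, of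
      probability one, where both points belong to separable sets. *)

(** * Laws, null sets and L^p norms *)

Lemma measurable_preimage d d' (T : measurableType d) (T' : measurableType d')
    (f : T -> T') (A : set T') :
  measurable_fun setT f -> measurable A -> measurable (f @^-1` A).
Proof. by move=> mf mA; rewrite -[X in measurable X]setTI; exact: mf. Qed.

Section almost_everywhere.
Context d (T : measurableType d) (R : realType) (P : probability T R).
Local Open Scope ereal_scope.

Lemma ae_probability1 (A : set T) : measurable A -> P A = 1 ->
  {ae P, forall t, A t}.
Proof.
move=> mA PA; exists (~` A); split => //; first exact: measurableC.
by have := probability_setC P mA; rewrite PA subee.
Qed.

Lemma ae_le_probability (A B : set T) : measurable A -> measurable B ->
  {ae P, forall t, A t -> B t} -> P A <= P B.
Proof.
move=> mA mB [N [mN PN AB]].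
have AU : A `<=` B `|` N.
  move=> t At; have [Bt|Bt] := pselect (B t); first by left.
  by right; apply: AB => /(_ At).
have mBN : measurable (B `|` N) by exact: measurableU.
apply: (@le_trans _ _ (P (B `|` N))); first by apply: le_measure; rewrite ?inE.
apply: (le_trans (measureU2 P mB mN)).
by rewrite [X in _ + X](_ : _ = 0)// adde0.
Qed.

Lemma ae_eq_probability (A B : set T) : measurable A -> measurable B ->
  {ae P, forall t, A t <-> B t} -> P A = P B.
Proof.
move=> mA mB AB; apply/eqP; rewrite eq_le; apply/andP.
by split; apply: ae_le_probability => //; apply: filterS AB => t -[].
Qed.

Lemma ae_comp d' (T' : measurableType d') (Q : {measure set T' -> \bar R})
    (f : T -> T') (A : set T') : measurable_fun setT f ->
  (forall B, measurable B -> P (f @^-1` B) = Q B) ->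
  {ae Q, forall y, A y} -> {ae P, forall t, A (f t)}.
Proof.
move=> mf fQ [N [mN QN AN]]; exists (f @^-1` N); split.
- exact: measurable_preimage.
- exact: etrans (fQ _ mN) QN.
- by move=> t; exact: AN.
Qed.

End almost_everywhere.

Section law.
Context d d' (T : measurableType d) (T' : measurableType d') (R : realType).
Local Open Scope ereal_scope.

(** Packages the push-forward as a probability together with its change of
    variables. *)
Lemma exists_law (P : probability T R) (f : T -> T') : measurable_fun setT f ->
  exists2 Q : probability T' R, (forall A, Q A = P (f @^-1` A)) &
    forall g : T' -> \bar R, measurable_fun setT g -> (forall t, 0 <= g t) ->
      \int[Q]_t g t = \int[P]_t g (f t).
Proof.
move=> mf; pose F : {mfun T >-> T'} := mfun_Sub (mem_set mf).
exists (distribution P F : probability T' R) => // g mg g0.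
exact: ge0_integral_distribution.
Qed.

End law.

Lemma Lnorm_ge0E d (T : measurableType d) (R : realType)
    (mu : {measure set T -> \bar R}) (p : R) (b : T -> R) :
  (forall t, 0 <= b t) ->
  ('N[mu]_p%:E[EFin \o b] = (\int[mu]_t (b t `^ p)%:E) `^ p^-1)%E.
Proof.
by move=> b0; rewrite Lnorm.unlock; under eq_integral do rewrite /= ger0_norm//.
Qed.

Lemma measurable_ge_level d (T : measurableType d) (R : realType) (b : T -> R)
    (r : R) :
  measurable_fun setT b -> measurable [set t | r <= b t].
Proof.
move=> mb; rewrite (_ : [set t | _] = setT `&` b @^-1` `[r, +oo[%classic).
  exact: mb.
by apply/seteqP; split => t /=; rewrite in_itv/= andbT; [|case].
Qed.

Section Lnorm_probability.
Context d (T : measurableType d) (R : realType) (P : probability T R) (p : R).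
Hypothesis p1 : (1 <= p)%R.
Local Open Scope ereal_scope.

Let p0 : (0 < p)%R. Proof. exact: lt_le_trans p1. Qed.

Lemma le_Lnorm (b c : T -> R) : (forall t, 0 <= b t)%R -> (forall t, 0 <= c t)%R ->
  measurable_fun setT b -> measurable_fun setT c ->
  {ae P, forall t, b t <= c t}%R ->
  'N[P]_p%:E[EFin \o b] <= 'N[P]_p%:E[EFin \o c].
Proof.
move=> b0 c0 mb mc bc; rewrite (Lnorm_ge0E P p b0) (Lnorm_ge0E P p c0).
have I0 (f : T -> R) : 0 <= \int[P]_t (f t `^ p)%:E.
  by apply: integral_ge0 => t _; rewrite lee_fin powR_ge0.
apply: gt0_ler_poweR; [by rewrite invr_ge0 ltW|by rewrite in_itv/= leey andbT|
  by rewrite in_itv/= leey andbT|].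
apply: ae_ge0_le_integral => //.
- by move=> t _; rewrite lee_fin powR_ge0.
- by apply/measurable_EFinP; exact: (measurableT_comp (measurable_powR _)).
- by move=> t _; rewrite lee_fin powR_ge0.
- by apply/measurable_EFinP; exact: (measurableT_comp (measurable_powR _)).
- move: bc; apply: filterS => t bc _; rewrite lee_fin ge0_ler_powR ?nnegrE//.
  exact: ltW.
Qed.

Lemma Lnorm_prob_cst (c : R) : (0 <= c)%R -> 'N[P]_p%:E[EFin \o cst c] = c%:E.
Proof.
move=> c0; rewrite Lnorm_ge0E//.
have -> : \int[P]_t (cst c t `^ p)%:E = (c `^ p)%:E * P setT.
  exact: (integral_cst P measurableT (c `^ p)%:E).
rewrite probability_setT mule1.
by rewrite poweR_EFin -powRrM mulfV ?gt_eqF// powRr1.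
Qed.

(** Markov's inequality for the function [b ^ p]. *)
Lemma markov_Lnorm (b : T -> R) (r c : R) :
  measurable_fun setT b -> (forall t, 0 <= b t)%R ->
  (0 < r)%R -> (0 <= c)%R ->
  ('N[P]_p%:E[EFin \o b] <= c%:E)%E ->
  (P [set t | (r <= b t)%R] <= ((c / r) `^ p)%:E).
Proof.
move=> mb b0 r0 c0; rewrite (Lnorm_ge0E P p b0) => bc.
have mbp : measurable_fun setT (fun t => (b t `^ p)%:E).
  by apply/measurable_EFinP; exact: (measurableT_comp (measurable_powR _)).
have I0 : (0 <= \int[P]_t (b t `^ p)%:E)%E.
  by apply: integral_ge0 => t _; rewrite lee_fin powR_ge0.
have {bc}bc : (\int[P]_t (b t `^ p)%:E <= (c `^ p)%:E)%E.
  have pn0 : p != 0%R by rewrite gt_eqF.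
  rewrite -(poweRe1 I0) -(mulVf pn0) poweRrM -poweR_EFin.
  apply: gt0_ler_poweR; rewrite ?(ltW p0)// in_itv/= leey andbT ?poweR_ge0//.
have mE : measurable [set t | (r <= b t)%R] by exact: measurable_ge_level.
have rp0 : (0 < (r `^ p)%:E)%E by rewrite lte_fin powR_gt0.
rewrite -(lee_pmul2r _ rp0)// -EFinM -powRM ?divr_ge0 ?(ltW r0)// divfK ?gt_eqF//.
apply: le_trans bc.
apply: (@le_trans _ _ (\int[P]_(t in [set t | (r <= b t)%R]) (b t `^ p)%:E)%E).
  rewrite muleC -(integral_cst P mE).
  apply: ge0_le_integral => //.
  - by move=> t _; rewrite lee_fin powR_ge0.
  - exact: measurable_funTS.
  - by move=> t /= rb; rewrite lee_fin ge0_ler_powR ?nnegrE ?(ltW p0) ?(ltW r0).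
by apply: ge0_subset_integral => // t _; rewrite lee_fin powR_ge0.
Qed.

Lemma Lnorm_indic (c : R) (E : set T) : (0 <= c)%R -> measurable E ->
  ('N[P]_p%:E[EFin \o (fun t => (c * \1_E t)%R)] = c%:E * P E `^ p^-1)%E.
Proof.
move=> c0 mE; rewrite Lnorm_ge0E; last by move=> t; rewrite mulr_ge0.
have -> : (\int[P]_t ((c * \1_E t) `^ p)%:E = (c `^ p)%:E * P E)%E.
  under eq_integral => t _.
    rewrite (_ : ((c * \1_E t) `^ p)%R = (c `^ p * \1_E t)%R); last first.
      rewrite indicE; case: (t \in E); rewrite ?mulr1// !mulr0 powR0//.
      by rewrite gt_eqF.
    rewrite EFinM; over.
  rewrite ge0_integralZl_EFin ?powR_ge0 ?integral_indic ?setIT//.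
  exact/measurable_EFinP/measurable_indic.
rewrite poweRM ?measure_ge0 ?lee_fin ?powR_ge0// poweR_EFin -powRrM.
by rewrite mulfV ?gt_eqF// powRr1.
Qed.

End Lnorm_probability.

Section Lnorm_change_of_variables.
Context d d' (T : measurableType d) (T' : measurableType d') (R : realType).
Local Open Scope ereal_scope.

(** [Q] is compared with the law of [f] on measurable sets only, since measures
    are functions of all sets whose values elsewhere are arbitrary. *)
Lemma Lnorm_comp (M : probability T R) (Q : {measure set T' -> \bar R}) (f : T -> T')
    (b : T' -> R) (p : R) : measurable_fun setT f ->
  (forall A, measurable A -> M (f @^-1` A) = Q A) ->
  measurable_fun setT b -> (forall t, 0 <= b t)%R ->
  'N[M]_p%:E[EFin \o (b \o f)] = 'N[Q]_p%:E[EFin \o b].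
Proof.
move=> mf fQ mb b0; have [N NE NI] := exists_law M mf.
have mbp : measurable_fun setT (fun t => (b t `^ p)%:E).
  by apply/measurable_EFinP; exact: (measurableT_comp (measurable_powR _)).
have bE : \int[M]_t ((b \o f) t `^ p)%:E = \int[Q]_t (b t `^ p)%:E.
  rewrite -(NI _ mbp); last by move=> t; rewrite lee_fin powR_ge0.
  apply: eq_measure_integral => A mA _; exact: etrans (NE A) (fQ A mA).
rewrite (Lnorm_ge0E Q p b0) -bE; apply: Lnorm_ge0E => t; exact: b0.
Qed.

End Lnorm_change_of_variables.

(** * Borel sets of a metric space *)

Lemma borel_measurable_fun (R : realType) (Y : pmetricType R) d
    (O : measurableType d) (f : O -> borel Y) :
  (forall U, open U -> measurable (f @^-1` U)) -> measurable_fun setT f.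
Proof.
move=> mf; apply: (@measurability _ _ O (borel Y) _ _ open) => //.
by move=> _ [U oU <-]; rewrite setTI; exact: mf.
Qed.

Section carrier.
Variables (R : realType) (Y : pmetricType R).

Lemma open_borel (U : set Y) : open U -> measurable (U : set (borel Y)).
Proof. exact: sub_sigma_algebra. Qed.

Lemma closed_borel (F : set Y) : closed F -> measurable (F : set (borel Y)).
Proof.
move=> cF; rewrite -(setCK F); apply: measurableC.
by apply: open_borel; exact: closed_openC.
Qed.

Lemma compact_borel (K : set Y) : compact K -> measurable (K : set (borel Y)).
Proof.
by move=> cK; apply: closed_borel; apply: compact_closed => //; exact: metric_hausdorff.
Qed.

Lemma ball_open_metric (y : Y) (r : R) : open (ball y r).
Proof.
rewrite openE => z; rewrite ballEmdist /= => yz.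
apply/nbhs_ballP; exists (r - mdist y z); first by rewrite /= subr_gt0.
move=> t; rewrite !ballEmdist /= => zt.
by rewrite (le_lt_trans (metric_triangle _ z _))// -ltrBrDl.
Qed.

Lemma measurable_fst_borel :
  measurable_fun setT (fst : borel (Y * Y)%type -> borel Y).
Proof.
apply: (@borel_measurable_fun R Y _ (borel (Y * Y)%type)) => U oU.
by apply: sub_sigma_algebra; apply: open_comp => // z _; exact: cvg_fst.
Qed.

Lemma measurable_snd_borel :
  measurable_fun setT (snd : borel (Y * Y)%type -> borel Y).
Proof.
apply: (@borel_measurable_fun R Y _ (borel (Y * Y)%type)) => U oU.
by apply: sub_sigma_algebra; apply: open_comp => // z _; exact: cvg_snd.
Qed.

Lemma measurable_mdist :
  measurable_fun setT (fun z : borel (Y * Y)%type => mdist z.1 z.2 : R).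
Proof. exact: (continuous_borel (@mdist_continuous _ Y)). Qed.

Lemma compact_net (K : set Y) (eps : R) : compact K -> 0 < eps ->
  exists s : seq Y, forall y, K y -> exists2 x, x \in s & mdist x y < eps.
Proof.
move=> cK eps0; have : cover_compact K by rewrite -compact_cover.
move=> /(_ Y setT (fun x => (ball x eps)°)) [].
- by move=> x _; exact: open_interior.
- by move=> x Kx; exists x => //; exact: nbhsx_ballx.
move=> D _ KD; exists (finmap.enum_fset D) => y /KD [x /= xD xy]; exists x => //.
by move: (interior_subset xy); rewrite ballEmdist.
Qed.

(** Inner regularity exhausts [mu] by compact sets, which are totally bounded:
    [s] enumerates finite nets of these sets for all radii [1 / (m + 1)]. *)
Lemma radon_carrier (mu : probability (borel Y) R) : inner_regular mu ->
  exists (S : set (borel Y)) (s : nat -> Y), [/\ measurable S, mu S = 1%E &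
    forall y, S y -> forall eps : R, 0 < eps -> exists n, mdist (s n) y < eps].
Proof.
move=> rmu; have /choice[K KP] : forall n : nat, exists K : set Y,
    compact K /\ (1 - (n.+1%:R^-1)%:E < mu K)%E.
  move=> n; have := rmu setT measurableT; rewrite probability_setT => /esym muK.
  have : (1 - (n.+1%:R^-1)%:E < 1 :> \bar R)%E.
    by rewrite -EFinB lte_fin ltrBlDr ltrDl invr_gt0.
  by rewrite -[in X in (_ < X)%E -> _]muK => /ereal_sup_gt[_ [K [cK _] <-]] ?; exists K.
have /choice[net netP] : forall nm : nat * nat, exists s : seq Y,
    forall y, K nm.1 y -> exists2 x, x \in s & mdist x y < nm.2.+1%:R^-1.
  by move=> [n m]; apply: compact_net; [case: (KP n)|rewrite invr_gt0].
(* The index [k] codes a compact set, a radius and a position in the net. *)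
pose s (k : nat) : Y := if unpickle k is Some nmj then
  nth point (net nmj.1) nmj.2 else point.
have mK n : measurable (K n : set (borel Y)) by apply: compact_borel; case: (KP n).
have mS : measurable (\bigcup_n K n : set (borel Y)) by exact: bigcupT_measurable.
exists (\bigcup_n K n), s; split => //.
  apply/eqP; rewrite eq_le probability_le1//=; apply/lee_addgt0Pr => e e0.
  have [n ne] : exists n : nat, n.+1%:R^-1 < e.
    by have [n] := ltr_add_invr e0; rewrite add0r => ne; exists n.
  rewrite -leeBlDr//; apply: (@le_trans _ _ (mu (K n))).
    apply: ltW; apply: le_lt_trans (KP n).2.
    by rewrite -!EFinB lee_fin lerB// ltW.
  by apply: le_measure; rewrite ?inE//; exact: bigcup_sup.
move=> y [n _ Kny] eps eps0.
have [m me] : exists m : nat, m.+1%:R^-1 < eps.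
  by have [m] := ltr_add_invr eps0; rewrite add0r => ne; exists m.
have [x xn xy] := netP (n, m) y Kny.
exists (pickle ((n, m), index x (net (n, m)))); rewrite /s pickleK /= nth_index//.
exact: lt_trans me.
Qed.

End carrier.

(** * Gluing probabilities along a countable label *)

Section labels.
Context d (T : measurableType d).

Lemma measurable_fun_label (t : T -> nat) :
  (forall k, measurable (t @^-1` [set k])) -> measurable_fun setT t.
Proof.
move=> mt _ A _; rewrite setTI.
rewrite (_ : t @^-1` A = \bigcup_(k in A) t @^-1` [set k]).
  exact: bigcup_measurable.
by apply/seteqP; split => [x Ax|x [k Ak /= ->]//]; exists (t x).
Qed.

(** The label of a point is the first index [k] with [B k x], and 0 when there is
    none. *)
Lemma exists_label (B : nat -> set T) : (forall k, measurable (B k)) ->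
  exists2 t : T -> nat, measurable_fun setT t &
    forall x k, B k x -> B (t x) x.
Proof.
move=> mB; pose t x := xget 0%N [set k | seqDU B k x].
have mD k : measurable (seqDU B k) by exact: seqDU_measurable.
have tE x k : seqDU B k x -> t x = k.
  move=> Bkx; apply: xget_unique => // j Bjx.
  by have /(_ j k I I) := @trivIset_seqDU T B; apply; exists x.
exists t; last first.
  move=> x k Bkx; have : (\bigcup_k seqDU B k) x by rewrite -seqDU_bigcup_eq; exists k.
  by move=> [j _ Bjx]; rewrite (tE _ _ Bjx); case: Bjx.
apply: measurable_fun_label => k.
rewrite (_ : _ @^-1` _ = seqDU B k `|`
    (if k == 0%N then ~` \bigcup_j seqDU B j else set0)).
  apply: measurableU => //; case: ifP => // _; apply: measurableC.
  exact: bigcupT_measurable.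
apply/seteqP; split => x /=.
  rewrite /t; case: xgetP => [j -> /= Bjx <-|nB <-]; first by left.
  by right; rewrite eqxx => -[j _ Bjx]; exact: (nB j).
case=> [/tE//|]; case: eqP => // -> nB; rewrite /t; case: xgetP => // j _ Bjx.
by case: nB; exists j.
Qed.

End labels.

Section gluing_of_measures.
Context d1 d2 (T1 : measurableType d1) (T2 : measurableType d2) (R : realType).
Variables (P1 : probability T1 R) (P2 : probability T2 R).
Variables (t1 : T1 -> nat) (t2 : T2 -> nat).
Hypotheses (mt1 : measurable_fun setT t1) (mt2 : measurable_fun setT t2).
Hypothesis same_law : forall k, P1 (t1 @^-1` [set k]) = P2 (t2 @^-1` [set k]).
Local Open Scope ereal_scope.

Let A k := t1 @^-1` [set k].
Let B k := t2 @^-1` [set k].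

Let mA k : measurable (A k).
Proof. exact: measurable_preimage. Qed.

Let mB k : measurable (B k).
Proof. exact: measurable_preimage. Qed.

Let mAB k : measurable (A k `*` B k). Proof. exact: measurableX. Qed.

(* When the event [A k] is null the weight is [0^-1 = 0], and the cell with label
   [k] is discarded. *)
Let weight_ge0 k : (0 <= (fine (P1 (A k)))^-1 :> R)%R.
Proof. by rewrite invr_ge0 fine_ge0. Qed.

Let weight k : {nonneg R} := NngNum (weight_ge0 k).

Let cell k : {measure set (T1 * T2)%type -> \bar R} :=
  mscale (weight k) (mrestr (P1 \x P2) (mAB k)).

(** The coupling that makes the two coordinates independent conditionally on
    their common label. *)
Definition glued : set (T1 * T2)%type -> \bar R := mseries cell 0.

HB.instance Definition _ := Measure.on glued.

Let cellE k C D : measurable C -> measurable D ->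
  cell k (C `*` D) =
  ((fine (P1 (A k)))^-1)%:E * (P1 (C `&` A k) * P2 (D `&` B k)).
Proof.
move=> mC mD.
transitivity (((fine (P1 (A k)))^-1)%:E *
    (P1 \x P2) ((C `*` D) `&` (A k `*` B k))) => //.
rewrite -setXI product_measure1E//; exact: measurableI.
Qed.

Let cell_fst k C : measurable C -> cell k (C `*` setT) = P1 (C `&` A k).
Proof.
move=> mC; rewrite cellE// setTI -same_law -/(A k).
have [PA0|PA0] := eqVneq (P1 (A k)) 0.
  rewrite PA0 mule0 mule0; apply/esym/eqP; rewrite eq_le measure_ge0 andbT -PA0.
  by apply: le_measure; rewrite ?inE//; exact: measurableI.
rewrite muleCA -[X in _ * (_ * X)]fineK ?fin_num_measure// -EFinM mulVf ?mule1//.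
by rewrite fine_eq0 ?fin_num_measure.
Qed.

Let cell_snd k D : measurable D -> cell k (setT `*` D) = P2 (D `&` B k).
Proof.
move=> mD; rewrite cellE// setTI.
have [PA0|PA0] := eqVneq (P1 (A k)) 0.
  rewrite PA0 mul0e mule0; apply/esym/eqP; rewrite eq_le measure_ge0 andbT -PA0.
  rewrite [leRHS]same_law -/(B k).
  by apply: le_measure; rewrite ?inE//; exact: measurableI.
rewrite muleA -[X in _ * X * _]fineK ?fin_num_measure// -EFinM mulVf ?mul1e//.
by rewrite fine_eq0 ?fin_num_measure.
Qed.

Let sum_fibers d (T : measurableType d) (P : probability T R) (t : T -> nat) C :
  (forall k, measurable (t @^-1` [set k])) -> measurable C ->
  \sum_(0 <= k <oo) P (C `&` t @^-1` [set k]) = P C.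
Proof.
move=> mt mC; rewrite -measure_semi_bigcup => //.
- by congr (P _); apply/seteqP; split => [x [k _ []//]|x Cx]; exists (t x).
- by move=> k; exact: measurableI.
- by move=> i j _ _ [x [[_ <-] [_ <-]]].
- by apply: bigcupT_measurable => k; exact: measurableI.
Qed.

Let glued_fst C : measurable C -> glued (C `*` setT) = P1 C.
Proof.
move=> mC; rewrite -(sum_fibers P1 mA mC) /glued /= /mseries.
by apply: eq_eseriesr => k _; exact: cell_fst.
Qed.

Let glued_snd D : measurable D -> glued (setT `*` D) = P2 D.
Proof.
move=> mD; rewrite -(sum_fibers P2 mB mD) /glued /= /mseries.
by apply: eq_eseriesr => k _; exact: cell_snd.
Qed.

Let glued_eq : {ae glued, forall z, t1 z.1 = t2 z.2}.
Proof.
exists (~` \bigcup_k (A k `*` B k)); split.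
- by apply: measurableC; exact: bigcupT_measurable.
- rewrite /glued /= /mseries eseries0// => k _ _.
  transitivity (((fine (P1 (A k)))^-1)%:E *
    (P1 \x P2) ((~` \bigcup_k (A k `*` B k)) `&` (A k `*` B k))) => //.
  rewrite (_ : _ `&` _ = set0) ?measure0 ?mule0//.
  by apply/seteqP; split => // z [/= nz ABz]; apply: nz; exists k.
- move=> z /= tz [k _ [/= Ak Bk]]; apply: tz; exact: (etrans Ak (esym Bk)).
Qed.

Let glued1 : glued setT = 1.
Proof. by rewrite -setXTT glued_fst ?probability_setT. Qed.

HB.instance Definition _ := Measure_isProbability.Build _ _ _
  glued glued1.

(** Replaces the disintegration of couplings: the label is discrete, so that
    conditioning on it is elementary. *)
Lemma gluing : exists M : probability (T1 * T2)%type R,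
  [/\ forall C, measurable C -> M (fst @^-1` C) = P1 C,
      forall D, measurable D -> M (snd @^-1` D) = P2 D &
      {ae M, forall z, t1 z.1 = t2 z.2}].
Proof.
exists glued; split => [C mC|D mD|//].
  by rewrite -(glued_fst mC) setXT.
by rewrite -(glued_snd mD) setTX.
Qed.

End gluing_of_measures.

(** * Couplings from random points *)

Section maps_into_metric_space.
Variables (R : realType) (Y : pmetricType R).
Context d (O : measurableType d) (f h : O -> borel Y).
Hypotheses (mf : measurable_fun setT f) (mh : measurable_fun setT h).

(** On a separable rectangle an open set of the product is a countable union of
    products of balls, which is the reason why [t |-> (f t, h t)] is measurable
    there. *)
Lemma measurable_pair_open (S S' : set (borel Y)) (s s' : nat -> Y)
    (U : set (Y * Y)) : measurable S -> measurable S' ->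
  (forall y, S y -> forall eps : R, 0 < eps -> exists n, mdist (s n) y < eps) ->
  (forall y, S' y -> forall eps : R, 0 < eps -> exists n, mdist (s' n) y < eps) ->
  open U ->
  measurable ((f @^-1` S `&` h @^-1` S') `&` [set t | U (f t, h t)]).
Proof.
move=> mS mS' dS dS' oU.
pose rect (k l m : nat) : set (Y * Y) :=
  [set z | ball (s k) m.+1%:R^-1 z.1 /\ ball (s' l) m.+1%:R^-1 z.2].
pose G k l m : set O :=
  f @^-1` ball (s k) m.+1%:R^-1 `&` h @^-1` ball (s' l) m.+1%:R^-1.
have mG k l m : measurable (G k l m).
  by apply: measurableI; apply: measurable_preimage => //; apply: open_borel;
    exact: ball_open_metric.
rewrite (_ : _ `&` _ = (f @^-1` S `&` h @^-1` S') `&`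
    \bigcup_k \bigcup_l \bigcup_(m in [set m | rect k l m `<=` U]) G k l m); last first.
  apply/seteqP; split => t [[Sf Sh]] /=.
    move=> Ut; split=> //.
    have /nbhs_ballP[r /= r0 rU] : nbhs (f t : Y, h t : Y) U.
      exact: open_nbhs_nbhs.
    have r20 : 0 < r / 2 by rewrite divr_gt0.
    have [m] := ltr_add_invr r20; rewrite add0r => mr.
    have m0 : 0 < m.+1%:R^-1 :> R by rewrite invr_gt0.
    have [k kf] := dS _ Sf _ m0; have [l lh] := dS' _ Sh _ m0.
    exists k => //; exists l => //; exists m; last first.
      by split; rewrite /= ballEmdist.
    move=> -[y z] [/= ky lz]; apply: rU; split => /=.
      rewrite (splitr r); apply: (@ball_triangle _ _ (s k)).
        by apply: (le_ball (ltW mr)); apply: ball_sym; rewrite ballEmdist.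
      exact: (le_ball (ltW mr)).
    rewrite (splitr r); apply: (@ball_triangle _ _ (s' l)).
      by apply: (le_ball (ltW mr)); apply: ball_sym; rewrite ballEmdist.
    exact: (le_ball (ltW mr)).
  by move=> [k _ [l _ [m /= rU [ft ht]]]]; split=> //; exact: rU.
apply: measurableI; first by apply: measurableI; exact: measurable_preimage.
apply: bigcupT_measurable => k; apply: bigcupT_measurable => l.
exact: bigcup_measurable.
Qed.

(** The pair [(f, h)] is replaced by a constant outside the event [D] where both
    points are in separable sets: it becomes measurable for the Borel sets of the
    product, and its law is not affected.  The cost is controlled by a measurable
    majorant [b], because [mdist (f t) (h t)] itself need not be measurable. *)
Lemma coupling_of_maps (P : probability O R) (p : R) (mu nu : wasserstein_space p Y)
    (b : O -> R) : 1 <= p ->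
  (forall A, measurable A -> P (f @^-1` A) = mu A) ->
  (forall A, measurable A -> P (h @^-1` A) = nu A) ->
  measurable_fun setT b -> (forall t, 0 <= b t) ->
  {ae P, forall t, mdist (f t) (h t) <= b t} ->
  exists2 g : probability (borel (Y * Y)%type) R, is_coupling mu nu g &
    (transport_cost p g <= 'N[P]_p%:E[EFin \o b])%E.
Proof.
move=> p1 fmu hnu mb b0 fhb.
have [S [s [mS S1 dS]]] := radon_carrier (@wmeasure_radon _ _ _ mu).
have [S' [s' [mS' S'1 dS']]] := radon_carrier (@wmeasure_radon _ _ _ nu).
pose D := f @^-1` S `&` h @^-1` S'.
have aeD : {ae P, forall t, D t}.
  have aef : {ae P, forall t, S (f t)}.
    apply: (ae_comp mf fmu); exact: ae_probability1.
  have aeh : {ae P, forall t, S' (h t)}.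
    apply: (ae_comp mh hnu); exact: ae_probability1.
  by apply: filterS2 aef aeh.
have mD : measurable D by apply: measurableI; exact: measurable_preimage.
pose F (t : O) : borel (Y * Y)%type :=
  if `[< D t >] then (f t, h t) else (point, point).
have mF : measurable_fun setT F.
  apply: (@measurability _ _ O (borel (Y * Y)%type) _ _ open) => //.
  move=> _ [U oU <-]; rewrite setTI.
  have mDU : measurable (D `&` [set t | U (f t, h t)]).
    exact: (measurable_pair_open mS mS' dS dS' oU).
  have [Up|Up] := pselect (U (point, point)).
    rewrite (_ : F @^-1` U = (D `&` [set t | U (f t, h t)]) `|` ~` D).
      by apply: measurableU => //; exact: measurableC.
    apply/seteqP; split => t; rewrite /= /F; case: asboolP => Dt //=.
    - by left.
    - by right.
    - by case=> [[]|].
  rewrite (_ : F @^-1` U = D `&` [set t | U (f t, h t)])//.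
  by apply/seteqP; split => t; rewrite /= /F; case: asboolP => Dt //= -[].
have [g gE gI] := exists_law P mF.
exists g.
  move=> A mA; rewrite /pushforward !gE -fmu// -hnu//.
  have mA1 : measurable (fst @^-1` A : set (borel (Y * Y)%type)).
    exact: (measurable_preimage (@measurable_fst_borel _ Y)).
  have mA2 : measurable (snd @^-1` A : set (borel (Y * Y)%type)).
    exact: (measurable_preimage (@measurable_snd_borel _ Y)).
  split; apply: ae_eq_probability; try exact: measurable_preimage;
    by apply: filterS aeD => t Dt /=; rewrite /F; case: asboolP.
rewrite -[X in (X <= _)%E]/((\int[g]_z (mdist z.1 z.2 `^ p)%:E) `^ p^-1)%E.
rewrite gI//; last 2 first.
- exact: measurable_mdist_powR.
- by move=> z; rewrite lee_fin powR_ge0.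
rewrite -(@Lnorm_ge0E _ _ _ P p (fun t => mdist (F t).1 (F t).2)); last first.
  by move=> t; exact: mdist_ge0.
apply: le_Lnorm => //.
- by move=> t; exact: mdist_ge0.
- exact: (measurableT_comp (@measurable_mdist _ Y) mF).
- by apply: filterS2 fhb aeD => t ? Dt; rewrite /F; case: asboolP.
Qed.

End maps_into_metric_space.

(** * The Wasserstein pseudometric *)

Section wasserstein_pseudometric.
Variables (R : realType) (p : R) (p1 : 1 <= p) (Y : pmetricType R).
Implicit Types mu nu : wasserstein_space p Y.

Let p0 : 0 < p. Proof. exact: lt_le_trans p1. Qed.

Lemma measurable_mdistr (y : Y) :
  measurable_fun setT (fun x : borel Y => mdist y x : R).
Proof.
apply: (@continuous_borel _ Y (fun x : Y => mdist y x)) => x.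
apply/cvgrPdist_lt => /= eps eps0; move: (nbhsx_ballx x eps eps0).
apply: filterS => u; rewrite ballEmdist /= => xu.
have h1 := metric_triangle y x u; have h2 := metric_triangle y u x.
by rewrite (metric_sym u x) in h2; rewrite ltr_norml; lra.
Qed.

Lemma transport_costE (g : probability (borel (Y * Y)%type) R) :
  transport_cost p g =
  ('N[g]_p%:E[EFin \o (fun z : borel (Y * Y)%type => mdist z.1 z.2)])%E.
Proof. by apply/esym/Lnorm_ge0E => z; exact: mdist_ge0. Qed.

(** A discretization of almost every point of the space with error less than
    [eps]: [s (t y)] is the first point of a dense sequence that is close to
    [y]. *)
Lemma radon_label mu (eps : R) : 0 < eps ->
  exists (t : borel Y -> nat) (s : nat -> Y), measurable_fun setT t /\
    {ae mu, forall y, mdist (s (t y)) y < eps}.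
Proof.
move=> eps0; have [S [s [mS muS dS]]] := radon_carrier (@wmeasure_radon _ _ _ mu).
have [k|t mt tP] := @exists_label _ (borel Y) (fun k => ball (s k) eps).
  by apply: open_borel; exact: ball_open_metric.
exists t, s; split => //; apply: filterS (ae_probability1 mS muS) => y Sy.
have [k ky] := dS y Sy eps eps0.
by have := tP y k; rewrite !ballEmdist; exact.
Qed.

Lemma finite_moment_Lnorm mu : exists y : Y,
  ('N[mu]_p%:E[EFin \o (fun x : borel Y => mdist y x)] < +oo)%E.
Proof.
have [y yfin] := @wmeasure_moment _ _ _ mu.
exists y; rewrite Lnorm_ge0E; first exact: poweR_lty.
by move=> x; exact: mdist_ge0.
Qed.

Lemma Wp_le_maps d (O : measurableType d) (P : probability O R)
    (f h : O -> borel Y) (b : O -> R) mu nu (c : R) :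
  measurable_fun setT f -> measurable_fun setT h ->
  (forall A, measurable A -> P (f @^-1` A) = mu A) ->
  (forall A, measurable A -> P (h @^-1` A) = nu A) ->
  measurable_fun setT b -> (forall t, 0 <= b t) ->
  {ae P, forall t, mdist (f t) (h t) <= b t} ->
  ('N[P]_p%:E[EFin \o b] <= c%:E)%E -> Wp mu nu <= c.
Proof.
move=> mf mh fmu hnu mb b0 fhb bc.
have [g gc gb] := coupling_of_maps mf mh p1 fmu hnu mb b0 fhb.
exact: Wp_le gc (le_trans gb bc).
Qed.

(** Gluing along a constant label is the product coupling; its cost is finite
    because both moments are. *)
Lemma finite_cost_coupling mu nu :
  exists2 g : probability (borel (Y * Y)%type) R, is_coupling mu nu g &
    (transport_cost p g < +oo)%E.
Proof.
have [y yfin] := finite_moment_Lnorm mu; have [z zfin] := finite_moment_Lnorm nu.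
have [|||M [Mmu Mnu _]] := @gluing _ _ (borel Y) (borel Y) R mu nu (cst 0%N) (cst 0%N).
- exact: measurable_cst.
- exact: measurable_cst.
- move=> k; rewrite !preimage_cst; case: ifP => _; first by rewrite !probability_setT.
  by rewrite !measure0.
pose b1 (x : borel Y * borel Y) := mdist y x.1 : R.
pose b2 (x : borel Y * borel Y) := mdist z x.2 : R.
have mb1 : measurable_fun setT b1.
  exact: (measurableT_comp (measurable_mdistr y) measurable_fst).
have mb2 : measurable_fun setT b2.
  exact: (measurableT_comp (measurable_mdistr z) measurable_snd).
pose b := (b1 \+ (cst (mdist y z) \+ b2))%R.
have mb : measurable_fun setT b.
  by apply: measurable_funD => //; exact: measurable_funD.
have [||g gc gb] := @coupling_of_maps _ _ _ _ fst snd measurable_fst measurable_snd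
  M p mu nu b p1 Mmu Mnu mb.
- by move=> x; rewrite /b /b1 /b2 /= !addr_ge0// mdist_ge0.
- apply: aeW => -[u v]; rewrite /b /b1 /b2 /=.
  have := metric_triangle u y v; have := metric_triangle y z v.
  by rewrite (metric_sym u y); lra.
exists g => //; apply: le_lt_trans gb _.
apply: le_lt_trans (minkowski_EFin _ _ _ p1) _ => //; first exact: measurable_funD.
apply: lte_add_pinfty.
  by rewrite (@Lnorm_comp _ _ _ _ _ M mu fst _ p measurable_fst Mmu (measurable_mdistr y)
    (fun x => mdist_ge0 y x)).
apply: le_lt_trans (minkowski_EFin _ _ mb2 p1) _ => //.
apply: lte_add_pinfty; first by rewrite Lnorm_prob_cst ?mdist_ge0// ltry.
by rewrite (@Lnorm_comp _ _ _ _ _ M nu snd _ p measurable_snd Mnu (measurable_mdistr z)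
  (fun x => mdist_ge0 z x)).
Qed.

(** The definition of [Wp] takes the real part of an infimum; this is where
    finiteness of that infimum matters. *)
Lemma Wp_near_coupling mu nu (c : R) : Wp mu nu < c ->
  exists2 g : probability (borel (Y * Y)%type) R, is_coupling mu nu g &
    (transport_cost p g <= c%:E)%E.
Proof.
have [g0 g0c g0fin] := finite_cost_coupling mu nu.
rewrite /Wp -lte_fin fineK; last first.
  rewrite ge0_fin_numE; last by apply: le_ereal_inf_tmp => _ [h _ <-]; exact: poweR_ge0.
  by apply: le_lt_trans g0fin; apply: ereal_inf_lbound; exists g0.
by move=> /ereal_inf_lt[_ [g gc <-] gl]; exists g => //; exact: ltW.
Qed.

(** Exchange the coordinates of a nearly optimal coupling. *)
Lemma Wp_sym mu nu : Wp mu nu = Wp nu mu.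
Proof.
suff le mu1 mu2 : Wp mu2 mu1 <= Wp mu1 mu2 by apply/eqP; rewrite eq_le !le.
apply/ler_addgt0Pr => eps eps0.
have [g gc gl] : exists2 g : probability (borel (Y * Y)%type) R,
    is_coupling mu1 mu2 g & (transport_cost p g <= (Wp mu1 mu2 + eps)%:E)%E.
  by apply: Wp_near_coupling; rewrite ltrDl.
apply: (@Wp_le_maps _ _ g snd fst _ _ _ _ (@measurable_snd_borel _ Y)
  (@measurable_fst_borel _ Y) _ _ (@measurable_mdist _ Y)).
- by move=> A mA; case: (gc A mA).
- by move=> A mA; case: (gc A mA).
- by move=> z; exact: mdist_ge0.
- by apply: aeW => z; rewrite metric_sym.
- by rewrite -transport_costE.
Qed.

Lemma Wp_eq_measure mu nu :
  (forall A : set (borel Y), measurable A -> mu A = nu A) -> Wp mu nu = 0.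
Proof.
move=> munu; apply/eqP; rewrite eq_le Wp_ge0 andbT.
apply: (@Wp_le_maps _ _ mu id id (cst 0)) => //.
- by apply: aeW => z; rewrite mdistxx.
- by rewrite Lnorm_prob_cst.
Qed.

(** Let [(x, y)] and [(y', z)] follow nearly optimal couplings, glued along the
    cell of the point with law [mu2].  Then [y] and [y'] are close to the same
    point [s (t y)], and Minkowski's inequality bounds the norm of
    [d(x, y) + eps / 2 + d(y', z)]. *)
Lemma Wp_triangle mu2 mu1 mu3 : Wp mu1 mu3 <= Wp mu1 mu2 + Wp mu2 mu3.
Proof.
apply/ler_addgt0Pr => eps eps0; have e40 : 0 < eps / 4 by rewrite divr_gt0.
have [g12 g12c g12l] : exists2 g : probability (borel (Y * Y)%type) R,
    is_coupling mu1 mu2 g & (transport_cost p g <= (Wp mu1 mu2 + eps / 4)%:E)%E.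
  by apply: Wp_near_coupling; rewrite ltrDl.
have [g23 g23c g23l] : exists2 g : probability (borel (Y * Y)%type) R,
    is_coupling mu2 mu3 g & (transport_cost p g <= (Wp mu2 mu3 + eps / 4)%:E)%E.
  by apply: Wp_near_coupling; rewrite ltrDl.
have [t [s [mt aet]]] := radon_label mu2 e40.
have mfst := @measurable_fst_borel _ Y; have msnd := @measurable_snd_borel _ Y.
have [|||M [M12 M23 Meq]] := @gluing _ _ (borel (Y * Y)%type) (borel (Y * Y)%type) R
  g12 g23 (t \o snd) (t \o fst).
- exact: measurableT_comp.
- exact: measurableT_comp.
- move=> k; have mtk : measurable (t @^-1` [set k]).
    exact: measurable_preimage.
  exact: etrans (g12c _ mtk).2 (esym (g23c _ mtk).1).
pose b1 (z : borel (Y * Y)%type * borel (Y * Y)%type) : R := mdist z.1.1 z.1.2.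
pose b2 (z : borel (Y * Y)%type * borel (Y * Y)%type) : R := mdist z.2.1 z.2.2.
have mb1 : measurable_fun setT b1.
  exact: (measurableT_comp (@measurable_mdist _ Y) measurable_fst).
have mb2 : measurable_fun setT b2.
  exact: (measurableT_comp (@measurable_mdist _ Y) measurable_snd).
pose b := (b1 \+ (cst (eps / 2) \+ b2))%R.
have mb : measurable_fun setT b.
  by apply: measurable_funD => //; exact: measurable_funD.
pose y1 (z : borel (Y * Y)%type * borel (Y * Y)%type) : borel Y := z.1.2.
pose y2 (z : borel (Y * Y)%type * borel (Y * Y)%type) : borel Y := z.2.1.
have my1 : measurable_fun setT y1 := measurableT_comp msnd measurable_fst.
have my2 : measurable_fun setT y2 := measurableT_comp mfst measurable_snd.
have My1 A : measurable A -> M (y1 @^-1` A) = mu2 A.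
  by move=> mA; exact: etrans (M12 _ (measurable_preimage msnd mA)) (g12c A mA).2.
have My2 A : measurable A -> M (y2 @^-1` A) = mu2 A.
  by move=> mA; exact: etrans (M23 _ (measurable_preimage mfst mA)) (g23c A mA).1.
have ae1 := ae_comp my1 My1 aet; have ae2 := ae_comp my2 My2 aet.
apply: (@Wp_le_maps _ _ M (fst \o fst) (snd \o snd) b) => //.
- exact: (measurableT_comp mfst measurable_fst).
- exact: (measurableT_comp msnd measurable_snd).
- by move=> A mA; exact: etrans (M12 _ (measurable_preimage mfst mA)) (g12c A mA).1.
- by move=> A mA; exact: etrans (M23 _ (measurable_preimage msnd mA)) (g23c A mA).2.
- by move=> x; rewrite /b /b1 /b2 /= !addr_ge0// ?mdist_ge0// divr_ge0// ltW.
- apply: filterS3 Meq ae1 ae2 => -[[x y] [y' z]] /= <- xy yz.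
  rewrite /b /b1 /b2 /=.
  have h1 := metric_triangle x y z; have h2 := metric_triangle y y' z.
  have h3 := metric_triangle y (s (t y)) y'.
  by rewrite (metric_sym y (s (t y))) in h3; lra.
apply: (le_trans (minkowski_EFin _ mb1 _ p1)) => //; first exact: measurable_funD.
rewrite [leRHS](_ : _ = (Wp mu1 mu2 + eps / 4)%:E +
  ((eps / 2)%:E + (Wp mu2 mu3 + eps / 4)%:E))%E; last first.
  by rewrite -!EFinD; congr EFin; lra.
apply: leeD.
  rewrite (@Lnorm_comp _ _ _ _ _ M g12 fst _ p measurable_fst M12
    (@measurable_mdist _ Y)) -?transport_costE// => z; exact: mdist_ge0.
apply: (le_trans (minkowski_EFin _ _ mb2 p1)) => //.
have e20 : 0 <= eps / 2 by rewrite divr_ge0// ltW.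
apply: leeD; first by rewrite (Lnorm_prob_cst M p1 e20).
rewrite (@Lnorm_comp _ _ _ _ _ M g23 snd _ p measurable_snd M23
  (@measurable_mdist _ Y)) -?transport_costE// => z; exact: mdist_ge0.
Qed.

End wasserstein_pseudometric.

Section wasserstein_separates.
Variables (R : realType) (p : R) (p1 : 1 <= p) (Y : pmetricType R).
Implicit Types mu nu : wasserstein_space p Y.

Let p0 : 0 < p. Proof. exact: lt_le_trans p1. Qed.

(** Under a coupling of cost at most [r * e ^ (1 / p)] the mass moved by a
    distance [r] or more is at most [e], so all of [K] except a mass [e] stays in
    the [r]-neighbourhood of [K]. *)
Lemma compact_mass_le mu nu (K : set Y) (r : R) : Wp mu nu = 0 -> compact K ->
  0 < r -> (mu K <= nu (\bigcup_(x in K) ball x r))%E.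
Proof.
move=> munu0 cK r0; set V := \bigcup_(x in K) _.
have mK : measurable (K : set (borel Y)) by exact: compact_borel.
have mV : measurable (V : set (borel Y)).
  by apply: open_borel; apply: bigcup_open => x _; exact: ball_open_metric.
have mfst := @measurable_fst_borel _ Y; have msnd := @measurable_snd_borel _ Y.
apply/lee_addgt0Pr => e e0; pose c := r * e `^ p^-1.
have c0 : 0 < c by rewrite mulr_gt0// powR_gt0.
have [g gc gl] : exists2 g : probability (borel (Y * Y)%type) R,
    is_coupling mu nu g & (transport_cost p g <= c%:E)%E.
  by apply: Wp_near_coupling; rewrite ?munu0.
rewrite transport_costE in gl.
have := markov_Lnorm p1 (@measurable_mdist _ Y) (fun z => mdist_ge0 _ _) r0 (ltW c0) gl.
rewrite /c mulrAC divff ?gt_eqF// mul1r -powRrM mulVf ?gt_eqF// powRr1 ?(ltW e0)//.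
set E := [set t | _] => gE.
have mE : measurable E := measurable_ge_level r (@measurable_mdist _ Y).
have mK1 : measurable (fst @^-1` K : set (borel (Y * Y)%type)).
  exact: (measurable_preimage mfst).
have mV2 : measurable (snd @^-1` V : set (borel (Y * Y)%type)).
  exact: (measurable_preimage msnd).
rewrite -(gc _ mK).1 -(gc _ mV).2 /pushforward.
apply: (@le_trans _ _ (g (snd @^-1` V `|` E))).
  apply: le_measure; rewrite ?inE//; first exact: measurableU.
  move=> [x y] /= Kx; have [xy|xy] := leP r (mdist x y); first by right.
  by left; exists x => //; rewrite ballEmdist.
by apply: le_trans (measureU2 _ mV2 mE) _; exact: leeD.
Qed.

(** For compact sets let the radius of the neighbourhood tend to 0; inner
    regularity extends the inequality to Borel sets. *)
Lemma Wp_eq0_le mu nu : Wp mu nu = 0 ->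
  forall A : set (borel Y), measurable A -> (mu A <= nu A)%E.
Proof.
move=> munu0 A mA; rewrite (@wmeasure_radon _ _ _ mu A mA).
apply: ge_ereal_sup => _ [K [cK KA] <-].
have mK : measurable (K : set (borel Y)) by exact: compact_borel.
apply: (@le_trans _ _ (nu K)); last by apply: le_measure; rewrite ?inE.
pose V (n : nat) : set (borel Y) := \bigcup_(x in K) ball x n.+1%:R^-1.
have mV n : measurable (V n).
  by apply: open_borel; apply: bigcup_open => x _; exact: ball_open_metric.
have VK : \bigcap_n V n = K.
  apply/seteqP; split => y; last first.
    by move=> Ky n _; exists y => //; exact: ballxx.
  move=> Vy; have cKK : closed K by apply: compact_closed => //; exact: metric_hausdorff.
  apply: cKK => B /nbhs_ballP[r /= r0 rB].
  have [n] := ltr_add_invr r0; rewrite add0r => nr.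
  have [x Kx xy] := Vy n I; exists x; split => //.
  by apply: rB; apply: (le_ball (ltW nr)); exact: ball_sym.
have : nu (V n) @[n --> \oo] --> nu K.
  rewrite -VK; apply: nonincreasing_cvg_mu => //.
  - by rewrite (le_lt_trans (probability_le1 _ _))// ltry.
  - by rewrite VK.
  - move=> n m nm; apply/subsetPset => y [x Kx xy]; exists x => //.
    by apply: le_ball xy; rewrite lef_pV2 ?posrE// ler_nat.
move=> /cvg_lim <-//; apply: lime_ge; last first.
  by apply: nearW => n; exact: compact_mass_le.
apply: ereal_nonincreasing_is_cvgn => n m nm; apply: le_measure; rewrite ?inE//.
by move=> y [x Kx xy]; exists x => //; apply: le_ball xy; rewrite lef_pV2 ?posrE// ler_nat.
Qed.

Lemma Wp_eq0 mu nu : Wp mu nu = 0 <->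
  forall A : set (borel Y), measurable A -> mu A = nu A.
Proof.
split; last exact: Wp_eq_measure.
move=> munu A mA; apply/eqP; rewrite eq_le Wp_eq0_le//= Wp_eq0_le//.
by rewrite Wp_sym.
Qed.

End wasserstein_separates.

(** * Moving the atoms of empirical measures *)

Section transfer.
Variables (R : realType) (p : R) (p1 : 1 <= p).

Lemma empirical_comp d d' (T : measurableType d) (T' : measurableType d') (N : nat)
    (u : 'I_N.+1 -> T) (f : T -> T') (A : set T') :
  empirical (R := R) u (f @^-1` A) = empirical (R := R) (f \o u) A.
Proof. by []. Qed.

(** Realizes an empirical measure as the law of a map on [nat] with the uniform
    law on the first [N + 1] integers: labels and atoms of equal value become
    points of a probability space. *)
Lemma empirical_inord d (T : measurableType d) (N : nat) (u : 'I_N.+1 -> T)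
    (A : set T) :
  empirical (R := R) (fun j : 'I_N.+1 => j : nat) ((u \o inord) @^-1` A) =
  empirical (R := R) u A.
Proof.
rewrite empirical_comp; congr (empirical _ A).
by apply/funext => j /=; rewrite inord_val.
Qed.

(** Equality with an atom is read off the label.  The label 0 is kept for the
    complement of the atoms, so that no almost sure statement is needed. *)
Lemma point_label (Y : pmetricType R) (N : nat) (x : 'I_N.+1 -> Y) :
  exists2 t : borel Y -> nat, measurable_fun setT t &
    forall y j, t y = t (x j) -> y = x j.
Proof.
pose B (k : nat) : set (borel Y) :=
  if k is k'.+1 then [set x (inord k')] else ~` range x.
have [k|t mt tP] := @exists_label _ (borel Y) B.
  have msing (F : set Y) : finite_set F -> measurable (F : set (borel Y)).
    by move=> finF; apply: compact_borel; exact: finite_compact.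
  case: k => [|k] /=; first by apply: measurableC; apply: msing; exact: finite_image.
  exact: msing.
exists t => // y j tyj.
have [k By] : exists k, B k y.
  have [[i _ iy]|ny] := pselect (range x y); last by exists 0%N.
  by exists i.+1; rewrite /= inord_val.
have := tP _ _ By; rewrite tyj.
have : B (t (x j)) (x j) by apply: (tP _ j.+1); rewrite /= inord_val.
by case: (t (x j)) => [[]|l /= -> ->]; [exists j|].
Qed.

(** Glue a nearly optimal coupling [g] of the first pair of measures with two
    uniform indices [j] and [k], once for each coordinate, so that almost surely
    [g] produces [(x j, y k)].  Then [(x' j, y' k)] is a coupling of the second
    pair, and its cost exceeds that of [g] by at most [eps].  Repeated atoms need
    no special treatment: conditionally on the value of the atom the index is
    uniform. *)
Lemma Wp_empirical_transfer (Y Y' : pmetricType R) (N M : nat)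
    (x : 'I_N.+1 -> Y) (y : 'I_M.+1 -> Y) (x' : 'I_N.+1 -> Y') (y' : 'I_M.+1 -> Y')
    (eps : R) : 0 <= eps ->
  (forall j k, mdist (x' j) (y' k) <= mdist (x j) (y k) + eps) ->
  Wp (wempirical p x') (wempirical p y') <=
  Wp (wempirical p x) (wempirical p y) + eps.
Proof.
move=> eps0 xy; apply/ler_addgt0Pr => e e0.
have [g gc gl] : exists2 g : probability (borel (Y * Y)%type) R,
    is_coupling (wempirical p x) (wempirical p y) g &
    (transport_cost p g <= (Wp (wempirical p x) (wempirical p y) + e)%:E)%E.
  by apply: Wp_near_coupling => //; rewrite ltrDl.
have mfst := @measurable_fst_borel _ Y; have msnd := @measurable_snd_borel _ Y.
have [tx mtx txP] := point_label x; have [ty mty tyP] := point_label y.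
have mnat d (T : measurableType d) (u : nat -> T) : measurable_fun setT u by [].
pose U K : probability nat R := @empirical _ nat R K (fun j : 'I_K.+1 => j : nat).
have [|||M1 [M1U M1g M1t]] := @gluing _ _ nat (borel (Y * Y)%type) R (U N) g
    (tx \o (x \o inord)) (tx \o fst).
- exact: mnat.
- exact: measurableT_comp.
- move=> k; have mk : measurable (tx @^-1` [set k]) by exact: measurable_preimage.
  exact: etrans (@empirical_inord _ (borel Y) N x (tx @^-1` [set k])) (esym (gc _ mk).1).
have [|||M2 [M2M1 M2U M2t]] := @gluing _ _ (nat * borel (Y * Y)%type)%type nat R
    M1 (U M) (ty \o (snd \o snd)) (ty \o (y \o inord)).
- apply: (measurableT_comp mty); exact: (measurableT_comp msnd measurable_snd).
- exact: mnat.
- move=> k; have mk : measurable (ty @^-1` [set k]) by exact: measurable_preimage.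
  apply: etrans (M1g _ (measurable_preimage msnd mk)) _.
  exact: etrans (gc _ mk).2 (esym (@empirical_inord _ (borel Y) M y (ty @^-1` [set k]))).
have msf : measurable_fun setT (fun z : (nat * borel (Y * Y)%type) * nat => z.1.2).
  exact: (measurableT_comp measurable_snd measurable_fst).
pose b := ((fun z : (nat * borel (Y * Y)%type) * nat => mdist z.1.2.1 z.1.2.2)
  \+ cst eps)%R : _ -> R.
have md : measurable_fun setT
    (fun z : (nat * borel (Y * Y)%type) * nat => mdist z.1.2.1 z.1.2.2 : R).
  exact: (measurableT_comp (@measurable_mdist _ Y) msf).
apply: (@Wp_le_maps _ _ p1 _ _ _ M2 (x' \o (inord \o (fst \o fst)))
  (y' \o (inord \o snd)) b).
- exact: (measurableT_comp (mnat _ (borel Y') (x' \o inord))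
    (measurableT_comp measurable_fst measurable_fst)).
- exact: (measurableT_comp (mnat _ (borel Y') (y' \o inord)) measurable_snd).
- move=> A mA; transitivity (U N ((x' \o inord) @^-1` A)).
    have mA' : measurable ((x' \o inord) @^-1` A) by [].
    exact: etrans (M2M1 _ (measurable_preimage measurable_fst mA')) (M1U _ mA').
  exact: (@empirical_inord _ (borel Y') N x' A).
- move=> A mA; exact: etrans (M2U ((y' \o inord) @^-1` A) _) (@empirical_inord _ (borel Y') M y' A).
- exact: measurable_funD.
- by move=> z; rewrite addr_ge0 ?mdist_ge0.
- have : {ae M2, forall z, tx (x (inord z.1.1)) = tx z.1.2.1}.
    exact: (ae_comp measurable_fst M2M1 M1t).
  apply: filterS2 M2t => -[[n z] m] /= /tyP zm /esym /txP zn.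
  by rewrite /b /= zm zn; exact: xy.
apply: (le_trans (minkowski_EFin _ md (measurable_cst eps) p1)).
rewrite (Lnorm_prob_cst M2 p1 eps0) addrAC EFinD leeD2r//.
rewrite (@Lnorm_comp _ _ _ _ _ M2 g (fun z => z.1.2) _ p msf _
    (@measurable_mdist _ Y) (fun z => mdist_ge0 _ _)); last first.
  move=> A mA; apply: etrans (M2M1 _ _) (M1g _ mA).
  exact: (measurable_preimage measurable_snd).
by rewrite -transport_costE.
Qed.

End transfer.

(** * Density of empirical measures *)

Lemma measurable_nat2 (A : set (nat * nat)) : measurable A.
Proof.
rewrite (_ : A = \bigcup_k \bigcup_(l in [set l | A (k, l)]) ([set k] `*` [set l])).
  by apply: bigcupT_measurable => k; apply: bigcup_measurable => l _; exact: measurableX.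
apply/seteqP; split => [[k l] Akl|[k l] [_ _ [l' /= Akl [/= -> ->]]]//].
by exists k => //; exists l.
Qed.

Section rounding.
Variables (R : realType) (n : nat) (q : nat -> R) (N : nat).
Hypotheses (q0 : forall k, 0 <= q k) (q1 : \sum_(k < n.+1) q k = 1).
Hypothesis q_eq0 : forall k, (n < k)%N -> q k = 0.

(* The atom [k] receives as many units of mass [1 / (N + 1)] as fit into [q k]. *)
Let copies k : nat := Num.truncn (N.+1%:R * q k).
Let wt k : R := (copies k)%:R / N.+1%:R.

Let wt_ge0 k : 0 <= wt k. Proof. by rewrite divr_ge0. Qed.

Let wt_le k : wt k <= q k.
Proof.
rewrite /wt ler_pdivrMr ?ltr0n// mulrC.
by have /truncn_itv/andP[] : 0 <= N.+1%:R * q k by rewrite mulr_ge0.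
Qed.

Let rest_ge0 k : 0 <= q k - wt k. Proof. by rewrite subr_ge0. Qed.

Let rest_le k : q k - wt k <= N.+1%:R^-1.
Proof.
rewrite lerBlDl /wt -[X in _ <= _ + X]mul1r -mulrDl ler_pdivlMr ?ltr0n// mulrC.
have /truncn_itv/andP[_ /ltW] : 0 <= N.+1%:R * q k by rewrite mulr_ge0.
by rewrite natr1.
Qed.

Let atoms : seq nat := flatten [seq nseq (copies k) k | k <- iota 0 n.+1].

Let sum_atoms (F : nat -> R) :
  \sum_(k <- atoms) F k = \sum_(k < n.+1) (copies k)%:R * F k.
Proof.
rewrite /atoms big_flatten big_map -[iota 0 n.+1]/(index_iota 0 n.+1) big_mkord.
by apply: eq_bigr => k _; rewrite big_nseq iter_addr_0 mulr_natl.
Qed.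

Let size_atoms : (size atoms)%:R = \sum_(k < n.+1) (copies k)%:R :> R.
Proof.
have := sum_atoms (fun=> 1); rewrite big_const_seq count_predT iter_addr_0 => ->.
by apply: eq_bigr => k _; rewrite mulr1.
Qed.

Let size_atoms_le : (size atoms <= N.+1)%N.
Proof.
rewrite -(ler_nat R) size_atoms -[leRHS]mulr1 -[X in _ <= _ * X]q1 mulr_sumr.
apply: ler_sum => k _.
by have := wt_le k; rewrite /wt ler_pdivrMr ?ltr0n// mulrC.
Qed.

(* Positions beyond [atoms] yield 0, where all the remaining mass is put. *)
Let atom (j : 'I_N.+1) : nat := nth 0%N atoms j.

Let sum_atom (F : nat -> R) : \sum_(j < N.+1) F (atom j) =
  \sum_(k < n.+1) (copies k)%:R * F k + (N.+1 - size atoms)%:R * F 0%N.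
Proof.
rewrite -sum_atoms (big_nth 0%N) -(big_mkord xpredT (fun j => F (nth 0%N atoms j))).
rewrite (@big_cat_nat _ _ _ (size atoms))//=; congr (_ + _).
rewrite (@eq_big_nat _ _ _ _ _ _ (fun=> F 0%N)); last first.
  by move=> j /andP[sj _]; rewrite nth_default.
by rewrite sumr_const_nat mulr_natl.
Qed.

Let mix k : {measure set (nat * nat) -> \bar R} :=
  measure_add (mscale (NngNum (wt_ge0 k)) \d_(k, k))
              (mscale (NngNum (rest_ge0 k)) \d_(k, 0%N)).

(** A coupling of the law [q] with the law of [atom], supported by the pairs
    [(k, k)] and [(k, 0)]: the part of [q k] that does not fill a unit moves
    to 0. *)
Definition rounded : set (nat * nat) -> \bar R := msum mix n.+1.

HB.instance Definition _ := Measure.on rounded.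

Let roundedE A : rounded A = (\sum_(k < n.+1)
  (wt k * (((k : nat), (k : nat)) \in A)%:R
   + (q k - wt k) * (((k : nat), 0%N) \in A)%:R))%:E.
Proof.
rewrite /rounded /msum -sumEFin; apply: eq_bigr => k _.
by apply: etrans (measure_addE _ _ A) _; rewrite EFinD !EFinM -!diracE.
Qed.

Let rounded_fst B : rounded (fst @^-1` B) = (\sum_(k < n.+1) q k * ((k : nat) \in B)%:R)%:E.
Proof.
rewrite roundedE; congr EFin; apply: eq_bigr => k _.
have -> l : (((k : nat), l) \in fst @^-1` B) = ((k : nat) \in B).
  by apply/idP/idP; rewrite !inE.
by rewrite -mulrDl addrC subrK.
Qed.

Let rounded1 : rounded setT = 1%E.
Proof.
rewrite -(preimage_setT fst) rounded_fst; congr EFin.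
by rewrite -[RHS]q1; apply: eq_bigr => k _; rewrite in_setT mulr1.
Qed.

HB.instance Definition _ := Measure_isProbability.Build _ _ _ rounded rounded1.

Let rounded_snd B : rounded (snd @^-1` B) = empirical atom B.
Proof.
rewrite roundedE /empirical; under [in RHS]eq_bigr do rewrite diracE.
rewrite sumEFin -EFinM; congr EFin.
rewrite (sum_atom (fun k => (k \in B)%:R)).
have -> : \sum_(k < n.+1) (wt k * (((k : nat), (k : nat)) \in snd @^-1` B)%:R
   + (q k - wt k) * (((k : nat), 0%N) \in snd @^-1` B)%:R) =
  \sum_(k < n.+1) wt k * ((k : nat) \in B)%:R +
  (\sum_(k < n.+1) (q k - wt k)) * (0%N \in B)%:R.
  rewrite mulr_suml -big_split; apply: eq_bigr => k _ /=.
  have E l : (((k : nat), l) \in snd @^-1` B) = (l \in B).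
    by apply/idP/idP; rewrite !inE.
  by rewrite !E.
have N0 : N.+1%:R != 0 :> R by rewrite pnatr_eq0.
rewrite mulrDr mulr_sumr; congr (_ + _).
  by apply: eq_bigr => k _; rewrite /wt mulrA [in LHS](mulrC _ _^-1).
rewrite mulrA; congr (_ * _); rewrite sumrB q1 natrB// mulrBr mulVf//.
rewrite size_atoms mulr_sumr; congr (_ - _).
by apply: eq_bigr => k _; rewrite /wt mulrC.
Qed.

Let rounded_off : (rounded [set z | z.1 != z.2] <= (n.+1%:R / N.+1%:R)%:E)%E.
Proof.
rewrite roundedE lee_fin -[n.+1 in leRHS]card_ord mulr_natl -sumr_const.
apply: ler_sum => k _.
have -> : (((k : nat), (k : nat)) \in [set z | z.1 != z.2]) = false.
  by apply/negbTE; rewrite notin_setE /= eqxx.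
rewrite mulr0 add0r; apply: le_trans (rest_le k).
by rewrite ler_piMr// lern1 leq_b1.
Qed.

Let rounded_bounded : {ae rounded, forall z, (z.1 <= n)%N /\ (z.2 <= n)%N}.
Proof.
exists (~` [set z | (z.1 <= n)%N /\ (z.2 <= n)%N]); split => //.
  exact: measurable_nat2.
rewrite roundedE big1// => k _.
have E l : (l <= n)%N ->
    (((k : nat), l) \in ~` [set z | (z.1 <= n)%N /\ (z.2 <= n)%N]) = false.
  move=> ln; apply/negbTE; rewrite notin_setE /=; apply; split => //.
  by rewrite -ltnS.
have kn : (k <= n)%N by rewrite -ltnS.
by rewrite (E _ kn) (E _ (leq0n n)) !mulr0 addr0.
Qed.

(** A law on [0 .. n] is close to one whose weights are multiples of
    [1 / (N + 1)]: each of the [n + 1] atoms gives up less than one unit. *)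
Lemma exists_rounding : exists (u : 'I_N.+1 -> nat) (Q : probability (nat * nat)%type R),
  [/\ forall k, Q (fst @^-1` [set k]) = (q k)%:E,
      forall B, Q (snd @^-1` B) = empirical u B,
      (Q [set z | (z.1 != z.2)%N] <= (n.+1%:R / N.+1%:R)%:E)%E &
      {ae Q, forall z, (z.1 <= n)%N /\ (z.2 <= n)%N}].
Proof.
exists atom, rounded; split => // k.
apply: etrans (rounded_fst _) _; congr EFin.
have [kn|nk] := leqP k n; last first.
  rewrite q_eq0// big1// => i _; rewrite (_ : _ \in _ = false) ?mulr0//.
  apply/negbTE; rewrite notin_setE /= => ik.
  by have := ltn_ord i; rewrite ik ltnS leqNgt nk.
rewrite (bigD1 (Ordinal (kn : (k < n.+1)%N)))//= mem_set// mulr1 big1 ?addr0// => i ik.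
rewrite (_ : _ \in _ = false) ?mulr0//; apply/negbTE; rewrite notin_setE /= => ikE.
by move/eqP: ik; apply; apply: val_inj.
Qed.

End rounding.

Section density.
Variables (R : realType) (p : R) (p1 : 1 <= p) (Y : pmetricType R).
Variable mu : wasserstein_space p Y.

Let p0 : 0 < p. Proof. exact: lt_le_trans p1. Qed.

(** Dominated convergence by the [p]-th moment: far labels contribute little to
    the cost. *)
Lemma finite_label_tail (t : borel Y -> nat) (y : Y) (r : R) :
  measurable_fun setT t -> (\int[mu]_x (mdist y x `^ p)%:E < +oo)%E -> 0 < r ->
  exists n, ('N[mu]_p%:E[EFin \o
    (fun x : borel Y => (mdist y x * (n <= t x)%N%:R)%R)] <= r%:E)%E.
Proof.
move=> mt fin r0; pose f n (x : borel Y) : R := mdist y x * (n <= t x)%N%:R.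
have f0 n x : 0 <= f n x by rewrite mulr_ge0// mdist_ge0.
have mf n : measurable_fun setT (f n).
  apply: measurable_funM; first exact: measurable_mdistr.
  exact: (@measurableT_comp _ _ _ _ _ _ (fun k => (n <= k)%N%:R : R) _ t).
have mfp n : measurable_fun setT (fun x => (f n x `^ p)%:E).
  by apply/measurable_EFinP; exact: (measurableT_comp (measurable_powR _)).
have cvgf : (\int[mu]_x (f n x `^ p)%:E @[n --> \oo] --> \int[mu]_x (cst 0 x))%E.
  apply: (@dominated_cvg _ _ _ mu setT measurableT _ _ (fun x => (mdist y x `^ p)%:E)).
  - exact: mfp.
  - move=> x _; apply: cvg_near_cst; exists (t x).+1 => // n /= tn.
    by rewrite /f leqNgt tn mulr0 powR0 ?gt_eqF.
  - by [].
  - apply/integrableP; split; first exact: measurable_mdistl_powR.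
    by under eq_integral do rewrite gee0_abs ?lee_fin ?powR_ge0//.
  - move=> n x _; rewrite gee0_abs ?lee_fin ?powR_ge0//.
    rewrite ge0_ler_powR ?nnegrE ?(ltW p0) ?mdist_ge0//.
    by rewrite ler_piMr ?mdist_ge0// lern1 leq_b1.
rewrite integral0 in cvgf.
have rp : (0 < (r `^ p)%:E)%E by rewrite lte_fin powR_gt0.
have [n _ nP] := cvgf _ (open_ereal_lt' rp).
exists n; rewrite (Lnorm_ge0E mu p (f0 n)).
have -> : r%:E = ((r `^ p)%:E `^ p^-1)%E.
  by rewrite poweR_EFin -powRrM mulfV ?gt_eqF// powRr1// ltW.
apply: gt0_ler_poweR; first by rewrite invr_ge0 ltW.
- rewrite in_itv/= leey andbT integral_ge0// => x _; by rewrite lee_fin powR_ge0.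
- by rewrite in_itv/= leey andbT lee_fin powR_ge0.
- by apply: ltW; exact: (nP n (leqnn n)).
Qed.

(** First send each point with label less than [n] to the centre of its cell and
    the others to a base point [y0], then round the weights of the resulting
    finite law.  The transport moves a point of label less than [n] by at most
    [r], the others by [mdist y0 x], and the rounding moves a small mass by at
    most [D], which bounds the mutual distances of the centres. *)
Lemma empirical_dense (eps : R) : 0 < eps ->
  exists (N : nat) (x : 'I_N.+1 -> Y), Wp (wempirical p x) mu < eps.
Proof.
move=> eps0; pose r := eps / 4; have r0 : 0 < r by rewrite divr_gt0.
have [t [s [mt aet]]] := radon_label mu r0.
have [y0 fin] := @wmeasure_moment _ _ _ mu.
have [n tail] := finite_label_tail mt fin r0.
have mnat d (T : measurableType d) (v : nat -> T) : measurable_fun setT v by [].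
(* The value 0 stands for the base point, [k + 1] for the centre [s k]. *)
pose v (k : nat) : nat := if (k < n)%N then k.+1 else 0%N.
pose t' := v \o t; have mt' : measurable_fun setT t' by exact: measurableT_comp.
pose a (k : nat) : Y := if k is k'.+1 then s k' else y0.
have t'n x : (t' x <= n)%N by rewrite /t' /v /=; case: ifP.
have mfib k : measurable (t' @^-1` [set k]).
  exact: measurable_preimage.
pose q k : R := fine (mu (t' @^-1` [set k])).
have q0 k : 0 <= q k by exact: fine_ge0.
have q_eq0 k : (n < k)%N -> q k = 0.
  move=> nk; rewrite /q (_ : _ @^-1` _ = set0) ?measure0//.
  by apply/seteqP; split => // x /= xk; move: (t'n x); rewrite xk leqNgt nk.
have q1 : \sum_(k < n.+1) q k = 1.
  apply: EFin_inj; rewrite -sumEFin -(probability_setT mu).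
  under eq_bigr do rewrite fineK ?fin_num_measure//.
  rewrite -(measure_bigsetU_ord mu xpredT (fun k => mfib (k : 'I_n.+1))).
    congr (mu _); apply/seteqP; split => // x _.
    rewrite (bigD1 (Ordinal (t'n x : (t' x < n.+1)%N)))//=; exact: or_introl.
  by move=> i j _ _ [x [/= xi xj]]; apply: val_inj; exact: etrans (esym xi) xj.
pose D : R := \sum_(k < n.+1) \sum_(l < n.+1) mdist (a k) (a l).
have D0 : 0 <= D by apply: sumr_ge0 => k _; apply: sumr_ge0 => l _; exact: mdist_ge0.
have D_ge k l : (k <= n)%N -> (l <= n)%N -> mdist (a k) (a l) <= D.
  move=> kn ln; rewrite /D (bigD1 (Ordinal (kn : (k < n.+1)%N)))//=.
  rewrite (bigD1 (Ordinal (ln : (l < n.+1)%N)))//= -addrA lerDl addr_ge0//.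
    by apply: sumr_ge0 => j _; exact: mdist_ge0.
  by apply: sumr_ge0 => i _; apply: sumr_ge0 => j _; exact: mdist_ge0.
have D10 : 0 < D + 1 by rewrite ltr_wpDl.
(* [D + 1] rather than [D], which may be 0. *)
have [N NP] : exists N : nat, n.+1%:R / N.+1%:R <= (r / (D + 1)) `^ p.
  have c0 : 0 < (r / (D + 1)) `^ p / n.+1%:R.
    by apply: divr_gt0 => //; apply: powR_gt0; exact: divr_gt0.
  have [N] := ltr_add_invr c0; rewrite add0r => NP; exists N.
  by move: (ltW NP); rewrite ler_pdivlMr// mulrC.
have [u [Q [Qfst Qsnd Qoff Qn]]] := exists_rounding N q0 q1 q_eq0.
exists N, (a \o u).
have [|||M [Mmu MQ Mt]] := @gluing _ _ (borel Y) (nat * nat)%type R mu Q t' fst.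
- exact: mt'.
- exact: measurable_fst.
- by move=> k; rewrite Qfst /q fineK// fin_num_measure.
pose E : set (nat * nat) := [set z | z.1 != z.2].
have mE : measurable E by exact: measurable_nat2.
pose b1 (z : borel Y * (nat * nat)) : R := mdist y0 z.1 * (n <= t z.1)%N%:R.
pose b2 (z : borel Y * (nat * nat)) : R := D * \1_E z.2.
have mt0 : measurable_fun setT (fun x : borel Y => mdist y0 x * (n <= t x)%N%:R : R).
  apply: measurable_funM; first exact: measurable_mdistr.
  exact: (@measurableT_comp _ _ _ _ _ _ (fun k => (n <= k)%N%:R : R) _ t).
have mD : measurable_fun setT (fun z : nat * nat => D * \1_E z : R).
  by apply: measurable_funM => //; exact: measurable_indic.
have mb1 : measurable_fun setT b1 := measurableT_comp mt0 measurable_fst.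
have mb2 : measurable_fun setT b2 := measurableT_comp mD measurable_snd.
pose b := (cst r \+ (b1 \+ b2))%R.
have mb : measurable_fun setT b.
  by apply: measurable_funD => //; exact: measurable_funD.
have b10 z : 0 <= b1 z by rewrite mulr_ge0// mdist_ge0.
have b20 z : 0 <= b2 z by rewrite mulr_ge0.
apply: (@le_lt_trans _ _ (r + (r + r))); last by rewrite /r; lra.
apply: (@Wp_le_maps _ _ p1 _ _ _ M (a \o (snd \o snd)) fst _ _ _ _ _ measurable_fst
  _ Mmu mb).
- exact: (measurableT_comp (mnat _ (borel Y) a)
    (measurableT_comp measurable_snd measurable_snd)).
- move=> A mA; have mA' : measurable (snd @^-1` (a @^-1` A) : set (nat * nat)).
    exact: measurable_nat2.
  exact: etrans (MQ _ mA') (Qsnd (a @^-1` A)).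
- by move=> z; rewrite /b /= !addr_ge0// ltW.
- have aeM2 : {ae M, forall z, (z.2.1 <= n)%N /\ (z.2.2 <= n)%N}.
    exact: (ae_comp measurable_snd MQ Qn).
  have aeM1 : {ae M, forall z, mdist (s (t z.1)) z.1 < r}.
    exact: (ae_comp measurable_fst Mmu aet).
  apply: filterS3 Mt aeM1 aeM2 => -[x [k l]] /= xk xr [kn ln].
  have h1 : mdist (a l) x <= mdist (a l) (a k) + mdist (a k) x.
    exact: metric_triangle.
  have h2 : mdist (a l) (a k) <= b2 (x, (k, l)).
    rewrite /b2 /= indicE; have [->|kl] := eqVneq k l.
      by rewrite mdistxx mulr_ge0.
    by rewrite mem_set// mulr1 D_ge.
  have h3 : mdist (a k) x <= r + b1 (x, (k, l)).
    rewrite /b1 /= -xk /t' /v /=; case: ltnP => tn /=.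
      by rewrite mulr0 addr0 ltW.
    by rewrite mulr1 lerDr ltW.
  by move: h1 h2 h3; rewrite /b /=; lra.
apply: (le_trans (minkowski_EFin _ _ _ p1)) => //; first exact: measurable_funD.
rewrite (Lnorm_prob_cst M p1 (ltW r0)) EFinD leeD2l//.
apply: (le_trans (minkowski_EFin _ mb1 mb2 p1)); rewrite EFinD; apply: leeD.
  by rewrite (@Lnorm_comp _ _ _ _ _ M mu fst _ p measurable_fst Mmu mt0)// => x;
    rewrite mulr_ge0// mdist_ge0.
rewrite (@Lnorm_comp _ _ _ _ _ M Q snd _ p measurable_snd MQ mD); last first.
  by move=> z; rewrite mulr_ge0.
rewrite (Lnorm_indic Q p1 D0 mE).
apply: (@le_trans _ _ (D%:E * (r / (D + 1))%:E)%E).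
  apply: lee_wpmul2l; first by rewrite lee_fin.
  have rD : 0 <= r / (D + 1) by rewrite divr_ge0// ltW.
  have -> : (r / (D + 1))%:E = (((r / (D + 1)) `^ p)%:E `^ p^-1)%E.
    by rewrite poweR_EFin -powRrM mulfV ?gt_eqF// powRr1.
  apply: gt0_ler_poweR; first by rewrite invr_ge0 ltW.
  - by rewrite in_itv/= leey andbT measure_ge0.
  - by rewrite in_itv/= leey andbT lee_fin powR_ge0.
  - by apply: le_trans Qoff _; rewrite lee_fin.
rewrite -EFinM lee_fin mulrCA ler_piMr ?(ltW r0)// ler_pdivrMr// mul1r.
by rewrite lerDl.
Qed.

End density.

(** * Ultralimits of pseudometric spaces *)

Lemma ltr_dist2 (R : realFieldType) (x r eps : R) :
  `|x - r| < eps -> x < r + eps /\ r < x + eps.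
Proof. by rewrite ltr_norml; lra. Qed.

Section pseudometric_ultralimit.
Variables (w : free_ultrafilter) (R : realType) (X : nat -> Type).
Variables (d : forall i, X i -> X i -> R) (e : forall i, X i).
Hypotheses (d_ge0 : forall i (x y : X i), 0 <= d x y).
Hypothesis dxx : forall i (x : X i), d x x = 0.
Hypothesis d_sym : forall i (x y : X i), d x y = d y x.
Hypothesis d_triangle : forall i (y x z : X i), d x z <= d x y + d y z.

Local Notation limit := (metric_ultralimit w d e).
Local Notation dist := (@ultralimit_dist w R X d e).
Local Notation ae P := (almost_surely w [set i | P i]).

(** A free ultrafilter contains every cofinite set. *)
Lemma almost_surely_ge (n : nat) : almost_surely w [set i | (n <= i)%N].
Proof.
elim: n => [|n IHn]; first by apply: filterE.
have [wn|wn] := in_ultra_setVsetC [set n] (ultra_filter w).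
  by case: (@ultra_nonprincipal w n).
apply: filterS2 IHn wn => i /= ni /eqP; rewrite ltn_neqAle ni andbT eq_sym.
by move/eqP => H; apply/eqP.
Qed.

Let near0 (x y : ultra_lim w d e) : Prop :=
  infinitely_close (ultra_dist d (sval x) (sval y)) (standard w 0).

Let near0P x y : near0 x y <-> forall eps : R, 0 < eps ->
  ae (fun i => d (ultra_repr (sval x) i) (ultra_repr (sval y) i) < eps).
Proof.
rewrite /near0 infinitely_closeP.
by split=> xy eps /xy; apply: filterS => i /=; rewrite subr0 ger0_norm.
Qed.

Let near0_refl x : near0 x x.
Proof. by apply/near0P => eps eps0; apply: filterE => i /=; rewrite dxx. Qed.

Let near0_sym x y : near0 x y -> near0 y x.
Proof.
move=> /near0P xy; apply/near0P => eps /xy.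
by apply: filterS => i /=; rewrite d_sym.
Qed.

Let near0_trans x y z : near0 x y -> near0 y z -> near0 x z.
Proof.
move=> /near0P xy /near0P yz; apply/near0P => eps eps0.
have e20 : 0 < eps / 2 by rewrite divr_gt0.
move: (xy _ e20) (yz _ e20); apply: filterS2 => i /= xyi yzi.
rewrite (le_lt_trans (d_triangle (ultra_repr (sval y) i) _ _))//.
by rewrite [ltRHS]splitr ltrD.
Qed.

Let pi_eq x y : ultralimit_pi x = ultralimit_pi y <-> near0 x y.
Proof. exact: (quot_piP near0_refl near0_sym near0_trans). Qed.

Lemma ultralimit_st_surj (a : limit) :
  exists x (hx : limited w d e x), a = ultralimit_st hx.
Proof.
case: (quot_repr a) (quot_reprK a) => u hu aE.
have uE : ultra_class w (ultra_repr u) = u by exact: ultra_reprK.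
have hx : limited w d e (ultra_repr u) by rewrite /limited uE.
exists (ultra_repr u), hx; rewrite -aE /ultralimit_st /ultralimit_pi.
by congr quot_pi; apply: eq_exist.
Qed.

(** The distance in the ultralimit is computed on representatives [sx], [sy]
    chosen in the classes; they are infinitely close to [x], [y], and the triangle
    inequality compares the distances. *)
Lemma ultralimit_distP x y (hx : limited w d e x) (hy : limited w d e y) (eps : R) :
  0 < eps ->
  ae (fun i => `|d (x i) (y i) - dist (ultralimit_st hx) (ultralimit_st hy)| < eps).
Proof.
pose rx : ultra_lim w d e := exist _ (ultra_class w x) hx.
pose ry : ultra_lim w d e := exist _ (ultra_class w y) hy.
pose sx := quot_repr (ultralimit_pi rx); pose sy := quot_repr (ultralimit_pi ry).
have xs : near0 rx sx by apply/pi_eq; rewrite /ultralimit_pi quot_reprK.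
have ys : near0 ry sy by apply/pi_eq; rewrite /ultralimit_pi quot_reprK.
move=> eps0; have e30 : 0 < eps / 3 by rewrite divr_gt0.
have fin : hfinite (ultra_dist d (sval sx) (sval sy)).
  have /hfiniteP[M xM] := svalP sx; have /hfiniteP[N yN] := svalP sy.
  apply/hfiniteP; exists (M + N); move: xM yN; apply: filterS2 => i /=.
  rewrite !ger0_norm// => xM yN.
  rewrite (le_trans (d_triangle (ultra_repr (ultra_class w e) i) _ _))//.
  by rewrite lerD// d_sym.
have /infinitely_closeP /(_ _ e30) std := st_close fin.
have /near0P /(_ _ e30) {}xs := xs; have /near0P /(_ _ e30) {}ys := ys.
have xE : ae (fun i => ultra_repr (sval rx) i = x i) := ultra_classK w x.
have yE : ae (fun i => ultra_repr (sval ry) i = y i) := ultra_classK w y.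
apply: filterS2 std (filterI (filterI xE yE) (filterI xs ys)) => i /= std
  [[-> ->] [xsi ysi]].
move: std; rewrite -/(dist _ _) -/sx -/sy.
set x' := ultra_repr _ i in xsi *; set y' := ultra_repr _ i in ysi *.
have h1 := d_triangle x' (x i) (y i); have h2 := d_triangle y' x' (y i).
have h3 := d_triangle (x i) x' y'; have h4 := d_triangle (y i) (x i) y'.
rewrite (d_sym y' (y i)) in h2; rewrite (d_sym x' (x i)) in h3.
rewrite /ultralimit_dist /= !ltr_norml; lra.
Qed.

Lemma ultralimit_dist_eq x y (hx : limited w d e x) (hy : limited w d e y) (r : R) :
  (forall eps, 0 < eps -> ae (fun i => `|d (x i) (y i) - r| < eps)) ->
  dist (ultralimit_st hx) (ultralimit_st hy) = r.
Proof.
move=> xyr; apply/eqP; rewrite -subr_eq0 -normr_eq0 eq_le normr_ge0 andbT.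
apply/ler_addgt0Pl => eps eps0; have e20 : 0 < eps / 2 by rewrite divr_gt0.
have [i [/= h1 h2]] := filter_ex (filterI (xyr _ e20) (ultralimit_distP hx hy e20)).
rewrite addr0 -(subrK (d (x i) (y i)) (dist _ _)) -addrA.
rewrite (le_trans (ler_normD _ _))// [leRHS]splitr.
by rewrite lerD// ltW// distrC.
Qed.

Lemma ultralimit_dist_le x y (hx : limited w d e x) (hy : limited w d e y) (c : R) :
  ae (fun i => d (x i) (y i) <= c) ->
  dist (ultralimit_st hx) (ultralimit_st hy) <= c.
Proof.
move=> xyc; apply/ler_addgt0Pr => eps eps0.
have [i [/= h1 h2]] := filter_ex (filterI xyc (ultralimit_distP hx hy eps0)).
by have [_ /ltW h3] := ltr_dist2 h2; rewrite (le_trans h3)// lerD2r.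
Qed.

Lemma ultralimit_dist_ge0 (a b : limit) : 0 <= dist a b.
Proof.
have [x [hx ->]] := ultralimit_st_surj a; have [y [hy ->]] := ultralimit_st_surj b.
apply/ler_addgt0Pr => eps eps0.
have [i /= /ltr_dist2[/ltW h _]] := filter_ex (ultralimit_distP hx hy eps0).
by rewrite (le_trans _ h).
Qed.

Lemma ultralimit_dist_sym (a b : limit) : dist a b = dist b a.
Proof.
have [x [hx ->]] := ultralimit_st_surj a; have [y [hy ->]] := ultralimit_st_surj b.
apply: ultralimit_dist_eq => eps /(ultralimit_distP hy hx).
by apply: filterS => i /=; rewrite d_sym.
Qed.

Lemma ultralimit_dist_triangle (b a c : limit) : dist a c <= dist a b + dist b c.
Proof.
have [x [hx ->]] := ultralimit_st_surj a; have [y [hy ->]] := ultralimit_st_surj b.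
have [z [hz ->]] := ultralimit_st_surj c.
apply/ler_addgt0Pr => eps eps0; apply: ultralimit_dist_le.
have e20 : 0 < eps / 2 by rewrite divr_gt0.
move: (ultralimit_distP hx hy e20) (ultralimit_distP hy hz e20).
apply: filterS2 => i /= /ltr_dist2[/ltW xy _] /ltr_dist2[/ltW yz _].
rewrite (le_trans (d_triangle (y i) _ _))//.
rewrite (splitr eps) addrACA.
exact: lerD xy yz.
Qed.

Lemma ultralimit_dist_eq0 (a b : limit) : dist a b = 0 <-> a = b.
Proof.
have [x [hx ->]] := ultralimit_st_surj a; have [y [hy ->]] := ultralimit_st_surj b.
split=> [xy|->]; last first.
  apply: ultralimit_dist_eq => eps eps0; apply: filterE => i /=.
  by rewrite dxx subr0 normr0.
apply/pi_eq/near0P => eps /(ultralimit_distP hx hy); rewrite xy.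
move: (ultra_classK w x) (ultra_classK w y); apply: filterS3 => i /= -> ->.
by rewrite subr0 ger0_norm.
Qed.

(** Diagonal argument.  Let [x n] represent [a n], and let [V n] be the set of
    indices at which [x 0, ..., x n] are hardly farther from [x n] than their
    classes are.  At the index [i] take the point [x (k i) i], where [k i] is
    the largest [n <= i] such that [i] is in [V n].  Since [i >= n] and [V n i]
    hold almost surely, [k i >= n] almost surely for each [n]. *)
Lemma ultralimit_complete (a : nat -> limit) :
  (forall eps : R, 0 < eps -> exists n0, forall m n, (n0 <= m)%N -> (n0 <= n)%N ->
    dist (a m) (a n) <= eps) ->
  exists b : limit, forall eps : R, 0 < eps -> exists n0, forall n, (n0 <= n)%N ->
    dist (a n) b <= eps.
Proof.
move=> cauchy_a.
pose x n := projT1 (cid (ultralimit_st_surj (a n))).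
pose hxE n := cid (projT2 (cid (ultralimit_st_surj (a n)))).
pose hx n : limited w d e (x n) := projT1 (hxE n).
have aE n : a n = ultralimit_st (hx n) := projT2 (hxE n).
pose V n : set nat := [set i | forall m, (m <= n)%N ->
  d (x m i) (x n i) < dist (a m) (a n) + n.+1%:R^-1].
have wV n : almost_surely w (V n).
  have inv0 : 0 < n.+1%:R^-1 :> R by rewrite invr_gt0.
  suff : ae (fun i => forall m : 'I_n.+1,
      d (x m i) (x n i) < dist (a m) (a n) + n.+1%:R^-1).
    by apply: filterS => i Vi m mn; exact: (Vi (Ordinal (mn : (m < n.+1)%N))).
  apply: filter_forall => m; rewrite (aE m) (aE n).
  by apply: filterS (ultralimit_distP (hx m) (hx n) inv0) => i /ltr_dist2[].
have /choice[k kP] : forall i, exists k, forall n, (n <= i)%N -> V n i ->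
    (n <= k)%N /\ V k i.
  move=> i; have [[n0 [n0i Vn0]]|nV] := pselect (exists n, (n <= i)%N /\ V n i).
    pose Q n := `[< (n <= i)%N /\ V n i >].
    have exQ : exists n, Q n by exists n0; exact/asboolP.
    have Qi n : Q n -> (n <= i)%N by move=> /asboolP[].
    case: (ex_maxnP exQ Qi) => k /asboolP[ki Vk] kmax.
    by exists k => n ni Vn; split => //; apply: kmax; exact/asboolP.
  by exists 0%N => n ni Vn; case: nV; exists n.
pose y i := x (k i) i.
have near_y n : ae (fun i => exists2 j, (n <= j)%N &
    d (x n i) (y i) < dist (a n) (a j) + n.+1%:R^-1).
  apply: filterS2 (wV n) (almost_surely_ge n) => i Vni ni.
  have [nk Vk] := kP i n ni Vni; exists (k i) => //.
  apply: lt_le_trans (Vk n nk) _; rewrite lerD2l lef_pV2 ?posrE//.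
  by rewrite ler_nat.
have hy : limited w d e y.
  have [n0 n0P] := cauchy_a 1 ltr01.
  have /limitedP[M xM] := hx n0.
  apply/limitedP; exists (M + (1 + n0.+1%:R^-1)).
  apply: filterS2 xM (near_y n0) => i /=; rewrite !ger0_norm// => xM [j n0j xy].
  rewrite (le_trans (d_triangle (x n0 i) _ _))// lerD// (le_trans (ltW xy))//.
  by rewrite lerD2r n0P.
exists (ultralimit_st hy) => eps eps0; have e20 : 0 < eps / 2 by rewrite divr_gt0.
have [n1 n1P] := cauchy_a _ e20.
have [n2] := ltr_add_invr e20; rewrite add0r => n2P.
exists (maxn n1 n2) => n; rewrite geq_max => /andP[n1n n2n].
rewrite (aE n); apply: ultralimit_dist_le.
apply: filterS (near_y n) => i [j nj xy]; apply: le_trans (ltW xy) _.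
rewrite [leRHS]splitr lerD//; first by rewrite n1P// (leq_trans n1n).
by apply: le_trans (ltW n2P); rewrite lef_pV2 ?posrE// ler_nat.
Qed.

End pseudometric_ultralimit.

(** * The canonical embedding *)

Lemma quadrilateral (R : realFieldType) (x y u v s t : R) :
  x <= u + s -> s <= y + v -> y <= u + t -> t <= x + v -> `|x - y| <= u + v.
Proof. by rewrite ler_norml; lra. Qed.

Section canonical_embedding.
Variables (w : free_ultrafilter) (R : realType) (p : R) (p1 : 1 <= p).
Variables (X : nat -> pmetricType R) (e : forall i, X i).

Local Notation Xhat := (space_ultralimit w e).
Local Notation What := (wasserstein_ultralimit w p e).
Local Notation dist := (@wasserstein_ultralimit_dist w R p X e).

Let Wpxx (Y : pmetricType R) (mu : wasserstein_space p Y) : Wp mu mu = 0.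
Proof. exact: Wp_eq_measure. Qed.

Let W_ge0 i (mu nu : wasserstein_space p (X i)) : 0 <= Wp mu nu := Wp_ge0 mu nu.
Let Wxx i (mu : wasserstein_space p (X i)) : Wp mu mu = 0 := Wpxx mu.
Let W_sym i (mu nu : wasserstein_space p (X i)) : Wp mu nu = Wp nu mu :=
  Wp_sym p1 mu nu.
Let W_triangle i (nu mu rho : wasserstein_space p (X i)) :
  Wp mu rho <= Wp mu nu + Wp nu rho := Wp_triangle p1 nu mu rho.

Let dist_eq0 (a b : What) : dist a b = 0 <-> a = b.
Proof. exact: (ultralimit_dist_eq0 W_ge0 Wxx W_sym W_triangle). Qed.

Let distxx (a : What) : dist a a = 0. Proof. exact/dist_eq0. Qed.

Let dist_ge0 (a b : What) : 0 <= dist a b.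
Proof. exact: (ultralimit_dist_ge0 W_ge0 Wxx W_sym W_triangle). Qed.

Let dist_sym (a b : What) : dist a b = dist b a.
Proof. exact: (ultralimit_dist_sym W_ge0 Wxx W_sym W_triangle). Qed.

Let dist_triangle (b a c : What) : dist a c <= dist a b + dist b c.
Proof. exact: (ultralimit_dist_triangle W_ge0 Wxx W_sym W_triangle). Qed.

(** Almost surely all the finitely many distances between atoms are within
    [eps / 2] of their limits; [Wp_empirical_transfer] applies in both
    directions. *)
Lemma empirical_isometry (N M : nat) (x : 'I_N.+1 -> forall i, X i)
    (y : 'I_M.+1 -> forall i, X i) (hx : forall j, space_limited w e (x j))
    (hy : forall k, space_limited w e (y k)) :
  dist (wasserstein_st (wempirical_limited p1 hx))
       (wasserstein_st (wempirical_limited p1 hy)) =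
  Wp (wempirical p (fun j => space_st (hx j)))
     (wempirical p (fun k => space_st (hy k))).
Proof.
apply: (ultralimit_dist_eq W_ge0 Wxx W_sym W_triangle) => eps eps0.
have e20 : 0 < eps / 2 by rewrite divr_gt0.
have : almost_surely w [set i | forall j k,
    `|mdist (x j i) (y k i) - mdist (space_st (hx j)) (space_st (hy k))| < eps / 2].
  apply: filter_forall => j; apply: filter_forall => k.
  exact: (@ultralimit_distP w R X (fun i => @mdist R (X i)) e
    (fun i => @mdist_ge0 _ (X i)) (fun i => @mdistxx _ (X i))
    (fun i => @metric_sym _ (X i)) (fun i y x z => @metric_triangle _ (X i) x y z)).
apply: filterS => i /= xy.
have le1 : Wp (wempirical p (fun j => x j i)) (wempirical p (fun k => y k i)) <=
    Wp (wempirical p (fun j => space_st (hx j)))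
       (wempirical p (fun k => space_st (hy k))) + eps / 2.
  apply: Wp_empirical_transfer => //; first exact: ltW.
  by move=> j k; have /ltr_dist2[/ltW] := xy j k.
have le2 : Wp (wempirical p (fun j => space_st (hx j)))
       (wempirical p (fun k => space_st (hy k))) <=
    Wp (wempirical p (fun j => x j i)) (wempirical p (fun k => y k i)) + eps / 2.
  apply: Wp_empirical_transfer => //; first exact: ltW.
  by move=> j k; have /ltr_dist2[_ /ltW] := xy j k.
by rewrite ltr_norml; move: le1 le2; lra.
Qed.

Lemma lift_points (N : nat) (xhat : 'I_N.+1 -> Xhat) :
  exists (x : 'I_N.+1 -> forall i, X i) (hx : forall j, space_limited w e (x j)),
    xhat = (fun j => space_st (hx j)).
Proof.
pose surj j := cid (@ultralimit_st_surj w R X (fun i => @mdist R (X i)) e (xhat j)).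
pose hx j := cid (projT2 (surj j)).
exists (fun j => projT1 (surj j)), (fun j => projT1 (hx j)).
by apply/funext => j; exact: (projT2 (hx j)).
Qed.

(* [a] is the prescribed image of some empirical measure at distance at most [r]
   from [mu]. *)
Let approximant (mu : wasserstein_space p Xhat) (r : R) (a : What) : Prop :=
  exists (N : nat) (x : 'I_N.+1 -> forall i, X i)
    (hx : forall j, space_limited w e (x j)),
    a = wasserstein_st (wempirical_limited p1 hx) /\
    Wp (wempirical p (fun j => space_st (hx j))) mu <= r.

(* The graph of the embedding, described without reference to a sequence of
   empirical measures: [b] is a limit of images of approximations of [mu]. *)
Let image_point (mu : wasserstein_space p Xhat) (b : What) : Prop :=
  forall r, 0 < r -> exists2 a, approximant mu r a & dist a b <= r.

Let exists_approximant mu (r : R) : 0 < r -> exists a, approximant mu r a.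
Proof.
move=> r0; have [N [xhat xmu]] := empirical_dense p1 mu r0.
have [x [hx xE]] := lift_points xhat.
exists (wasserstein_st (wempirical_limited p1 hx)), N, x, hx; split => //.
by rewrite -xE ltW.
Qed.

Let approximant_dist mu nu (r s : R) a b : approximant mu r a -> approximant nu s b ->
  `|dist a b - Wp mu nu| <= r + s.
Proof.
move=> [N [x [hx [-> xmu]]]] [M [y [hy [-> ynu]]]]; rewrite empirical_isometry.
set mu' := wempirical p _ in xmu *; set nu' := wempirical p _ in ynu *.
have h1 := Wp_triangle p1 mu mu' nu'; have h2 := Wp_triangle p1 nu mu nu'.
have h3 := Wp_triangle p1 mu' mu nu; have h4 := Wp_triangle p1 nu' mu' nu.
rewrite (Wp_sym p1 nu nu') in h2; rewrite (Wp_sym p1 mu mu') in h3.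
by rewrite ler_norml; move: xmu ynu h1 h2 h3 h4; lra.
Qed.

(* Yields at once that [image_point] is functional and that it is isometric. *)
Let image_point_dist mu nu b c : image_point mu b -> image_point nu c ->
  dist b c = Wp mu nu.
Proof.
move=> mub nuc; apply/eqP; rewrite -subr_eq0 -normr_eq0 eq_le normr_ge0 andbT.
apply/ler_addgt0Pl => eps eps0; rewrite addr0.
have r0 : 0 < eps / 2 / 2 by rewrite !divr_gt0.
have [a amu ab] := mub _ r0; have [a' anu ac] := nuc _ r0.
have h := approximant_dist amu anu.
have h1 := dist_triangle a b c; have h2 := dist_triangle a' a c.
have h3 := dist_triangle b a a'; have h4 := dist_triangle c b a'.
rewrite (dist_sym b a) in h1; rewrite (dist_sym c a') in h4.
have q := quadrilateral h1 h2 h3 h4.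
rewrite -(subrK (dist a a') (dist b c)) -addrA (le_trans (ler_normD _ _))//.
by apply: (le_trans (lerD (le_trans q (lerD ab ac)) h)); rewrite -!splitr.
Qed.

Let exists_image_point mu : exists b, image_point mu b.
Proof.
have inv0 n : 0 < n.+1%:R^-1 :> R by rewrite invr_gt0.
have /choice[a aP] := fun n => exists_approximant mu (inv0 n).
have small (r : R) : 0 < r -> exists n0, forall n, (n0 <= n)%N -> n.+1%:R^-1 <= r.
  move=> r0; have [n0] := ltr_add_invr r0; rewrite add0r => n0r.
  by exists n0 => n n0n; apply: le_trans (ltW n0r); rewrite lef_pV2 ?posrE// ler_nat.
have [|b ab] := @ultralimit_complete w R _ (fun i => @Wp R p (X i))
    (fun i => wdirac p (e i)) W_ge0 Wxx W_sym W_triangle a.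
  move=> eps eps0; have [n0 n0P] := small _ (divr_gt0 eps0 (ltr0Sn R 1)).
  exists n0 => m n n0m n0n; have := approximant_dist (aP m) (aP n).
  rewrite Wpxx subr0 => /(le_trans (ler_norm _)) /le_trans; apply.
  by rewrite [leRHS]splitr lerD// n0P.
exists b => r r0; have [n0 n0P] := small _ r0; have [n1 n1P] := ab _ r0.
exists (a (maxn n0 n1)); last by apply: n1P; rewrite leq_maxr.
have [N [x [hx [aE xmu]]]] := aP (maxn n0 n1); exists N, x, hx; split => //.
by apply: le_trans xmu _; apply: n0P; rewrite leq_maxl.
Qed.

Let image_point_empirical (N : nat) (x : 'I_N.+1 -> forall i, X i)
    (hx : forall j, space_limited w e (x j)) :
  image_point (wempirical p (fun j => space_st (hx j)))
    (wasserstein_st (wempirical_limited p1 hx)).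
Proof.
move=> r r0; exists (wasserstein_st (wempirical_limited p1 hx)).
  by exists N, x, hx; split => //; rewrite Wpxx ltW.
by rewrite distxx ltW.
Qed.

(* A Dirac measure and the empirical measure with one atom agree on Borel sets
   but are not the same set function, so they are only at distance zero. *)
Let image_point_dirac (x : forall i, X i) (hx : space_limited w e x) :
  image_point (wdirac p (space_st hx)) (wasserstein_st (wdirac_limited p1 hx)).
Proof.
have single (Y : pmetricType R) (y : Y) :
    Wp (wempirical p (fun _ : 'I_1 => y)) (wdirac p y) = 0.
  apply: Wp_eq_measure => // A mA.
  rewrite /= /empirical big_ord_recl big_ord0 adde0 invr1 mul1e//.
move=> r r0.
exists (wasserstein_st (wempirical_limited p1 (x := fun=> x) (fun _ : 'I_1 => hx))).
  exists 0%N, (fun=> x), (fun=> hx); split => //.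
  by rewrite single ltW.
apply: (ultralimit_dist_le W_ge0 Wxx W_sym W_triangle).
by apply: filterE => i /=; rewrite single ltW.
Qed.

(* The continuity clause in the definition of a canonical map forces its values
   to lie in the graph, whence uniqueness. *)
Let canonical_image_point (iota : wasserstein_space p Xhat -> What) mu :
  canonical_map p1 (w := w) (e := e) iota -> image_point mu (iota mu).
Proof.
move=> [iotaE iota_cvg] r r0.
have inv0 n : 0 < n.+1%:R^-1 :> R by rewrite invr_gt0.
have /choice[nu nuP] : forall n, exists nu : wasserstein_space p Xhat,
    is_empirical nu /\ Wp nu mu < n.+1%:R^-1.
  move=> n; have [N [x xmu]] := empirical_dense p1 mu (inv0 n).
  by exists (wempirical p x); split => //; exists N, x.
have nu_cvg : Wp (nu n) mu @[n --> \oo] --> 0.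
  apply/cvgrPdist_lt => eps eps0; have [n0] := ltr_add_invr eps0; rewrite add0r => n0P.
  exists n0 => // n /= n0n; rewrite sub0r normrN ger0_norm ?Wp_ge0//.
  apply: lt_le_trans (nuP n).2 _; apply: le_trans (ltW n0P).
  by rewrite lef_pV2 ?posrE// ler_nat.
have iota_nu := iota_cvg mu nu (fun n => (nuP n).1) nu_cvg.
have [n [/= nu_r iota_r]] : exists n, Wp (nu n) mu < r /\ dist (iota (nu n)) (iota mu) < r.
  have /cvgrPdist_lt /(_ r r0) h1 := nu_cvg.
  have /cvgrPdist_lt /(_ r r0) h2 := iota_nu.
  have [n [/= h3 h4]] := filter_ex (filterI h1 h2); exists n.
  by move: h3 h4; rewrite !sub0r !normrN !ger0_norm ?Wp_ge0.
exists (iota (nu n)); last exact: ltW.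
have [N [xhat nuE]] := (nuP n).1; have [x [hx xE]] := lift_points xhat.
exists N, x, hx; rewrite -iotaE -xE -nuE; split => //; exact: ltW.
Qed.

(** Any choice in the graph [image_point] is the embedding. *)
Theorem canonical_embedding :
  exists iota : wasserstein_space p Xhat -> What,
    [/\ unique (canonical_map p1 (w := w) (e := e)) iota,
        (forall mu nu, dist (iota mu) (iota nu) = Wp mu nu),
        (forall mu nu, iota mu = iota nu <->
          forall A : set (borel Xhat), measurable A -> mu A = nu A) &
        (forall (x : forall i, X i) (hx : space_limited w e x),
          iota (wdirac p (space_st hx)) =
          wasserstein_st (wdirac_limited p1 hx))].
Proof.
have /choice[iota iotaP] := exists_image_point.
have iso mu nu : dist (iota mu) (iota nu) = Wp mu nu.
  exact: image_point_dist.
have image_point_eq mu b : image_point mu b -> iota mu = b.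
  by move=> mub; apply/dist_eq0; rewrite (image_point_dist (iotaP mu) mub) Wpxx.
exists iota; split => //.
- split.
    split=> [N x hx|mu nu _ nu_cvg]; first exact: image_point_eq.
    by under eq_fun do rewrite iso.
  move=> iota' iota'P; apply/funext => mu; apply: image_point_eq.
  exact: canonical_image_point.
- by move=> mu nu; rewrite -(Wp_eq0 p1) -iso; exact: iff_sym.
- by move=> x hx; exact: image_point_eq.
Qed.

End canonical_embedding.

Theorem theorem11 (w : free_ultrafilter) (R : realType) (p : R) (p1 : 1 <= p)
    (X : nat -> completePMetricType R) (e : forall i, X i) :
  exists iota : wasserstein_space p (space_ultralimit w e) ->
                wasserstein_ultralimit w p e,
    [/\ unique (canonical_map p1 (w := w) (e := e)) iota,
        (forall mu nu, wasserstein_ultralimit_dist (iota mu) (iota nu) =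
                       Wp mu nu),
        (forall mu nu, iota mu = iota nu <->
          forall A : set (borel (space_ultralimit w e)),
            measurable A -> mu A = nu A) &
        (forall (x : forall i, X i) (hx : space_limited w e x),
          iota (wdirac p (space_st hx)) =
          wasserstein_st (wdirac_limited p1 hx))].
Proof. exact: canonical_embedding. Qed.
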